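(* Let $D\in\mathbb{R}^{m\times n}$, $S\in\mathcal{S}(D)$, $a>0$, $\eta\in(0,1)$, $t\in(0,(n-1)/2-\log(2(n-r_S)))$ and $$R\ge\gamma\sqrt{\frac{2\log(2(n-r_S))+2t}{n-1}},\qquad R>0 .$$ Assume that $n>8a$, that $$\lambda_0\ge\frac{R}{1-\eta},\qquad \|Df^0\|_1\le \frac{c\,\sigma\sqrt{1-\sqrt{8a/n}}}{\lambda_0},\qquad c=\sqrt{\left(\frac{\eta}{2}-\frac{\sqrt{r_S}+\sqrt{2a}}{\sqrt{n-\sqrt{8an}}}\right)^2+4}-2,$$ and that $S$ satisfies $$\eta>2\,\frac{\sqrt{r_S}+\sqrt{2a}}{\sqrt{n-\sqrt{8an}}} .$$ Let $\hat\epsilon=Y-\hat f_{\sqrt{}}$ be the residuals of the square root analysis estimator with tuning parameter $\lambda_0$. Then, with probability at least $1-3e^{-a}-e^{-t}$, $$\left|\frac{\|\hat\epsilon\|_n}{\|\epsilon\|_n}-1\right|\le\eta .$$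
   Context: Model: $f^0\in\mathbb{R}^n$ is a fixed signal and one observes $Y=f^0+\epsilon$ with $\epsilon\sim\mathcal{N}_n(0,\sigma^2 \mathrm{I}_n)$, $\sigma\in(0,\infty)$. For $f\in\mathbb{R}^n$, $\|f\|_n^2=\sum_{i=1}^n f_i^2/n$. The square root analysis estimator is $\hat f_{\sqrt{}}=\arg\min_{f\in\mathbb{R}^n}\{\|Y-f\|_n+\lambda_0\|Df\|_1\}$, $\lambda_0>0$. Active sets: $[m]=\{1,\dots,m\}$; $d_i'$ is the $i$-th row of $D$. For $S\subseteq[m]$, $-S=[m]\setminus S$, $s=|S|$, and $D_{-S}$ is the submatrix of $D$ with rows indexed by $-S$. Put $S(f)=\{j\in[m]: d_j'f\neq0\}$ and $\mathcal{S}(D)=\{S\subseteq[m]:\exists f\in\mathbb{R}^n,\ S=S(f)\}$. $r_S=\dim \mathcal{N}(D_{-S})$, the dimension of the nullspace of $D_{-S}$. Scaling factor: let $D_{-S}^+\in\mathbb{R}^{n\times(m-s)}$ be the Moore–Penrose pseudoinverse of $D_{-S}$, with columns $d_1^+,\dots,d_{m-s}^+$. Then $\gamma=\max_{i\in[m-s]}\|d_i^+\|_n$. *)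

(* Defs.v *)
From HB Require Import structures.
From mathcomp Require Import all_boot all_order all_algebra.
From mathcomp Require Import all_classical all_reals all_analysis.

Set Implicit Arguments.
Unset Strict Implicit.
Unset Printing Implicit Defensive.

Import Order.TTheory GRing.Theory Num.Theory.
Import numFieldNormedType.Exports.

Local Open Scope classical_set_scope.
Local Open Scope ring_scope.

Section Norms.
Context {K : realType}.

(* ||f||_n, normalised by the dimension *)
Definition norm_n n (f : 'cV[K]_n) : K :=
  Num.sqrt ((\sum_(i < n) f i 0 ^+ 2) / n%:R).

Definition norm_1 n (f : 'cV[K]_n) : K := \sum_(i < n) `|f i 0|.

End Norms.

Section MoorePenrose.
Context {K : realType}.

Definition is_pinv m n (A : 'M[K]_(m, n)) (X : 'M[K]_(n, m)) : Prop :=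
  [/\ A *m X *m A = A, X *m A *m X = X,
      (A *m X)^T = A *m X & (X *m A)^T = X *m A].

(* This is not [pinvmx], which is only a one-sided partial inverse; [pinvP] and
   [is_pinv_uniq] show that the default value 0 is never used and that the
   choice is canonical. *)
Definition pinv m n (A : 'M[K]_(m, n)) : 'M[K]_(n, m) :=
  xget 0 [set X | is_pinv A X].

Lemma is_pinv_uniq m n (A : 'M[K]_(m, n)) X Y :
  is_pinv A X -> is_pinv A Y -> X = Y.
Proof.
move=> [X1 X2 X3 X4] [Y1 Y2 Y3 Y4].
have AXY : A *m X = A *m Y.
  rewrite -{1}Y1 -mulmxA -Y3 -X3 -trmx_mul.
  by rewrite mulmxA X1 Y3.
have XYA : X *m A = Y *m A.
  rewrite -{1}Y1 !mulmxA -(mulmxA _ Y A) -Y4 -X4 -trmx_mul.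
  by rewrite -(mulmxA Y A) (mulmxA A X) X1 Y4.
by rewrite -X2 XYA -mulmxA AXY mulmxA Y2.
Qed.

Lemma gram_unit r n (F : 'M[K]_(r, n)) :
  row_free F -> F *m F^T \in unitmx.
Proof.
move=> Ff; rewrite -row_free_unit -kermx_eq0; apply/eqP/row_matrixP => i.
rewrite row0; set u := row i _.
have uG : u *m (F *m F^T) = 0 by rewrite -row_mul mulmx_ker row0.
have [v vE] : exists v, u *m F = v by exists (u *m F).
have vv0 : v *m v^T = 0.
  by rewrite -vE trmx_mul mulmxA -(mulmxA u) uG mul0mx.
apply: (row_free_inj Ff); rewrite mul0mx vE; apply/rowP => j.
move/matrixP: vv0 => /(_ 0 0); rewrite !mxE.
under eq_bigr do rewrite mxE -expr2.
move/eqP; rewrite psumr_eq0; last by move=> k _; exact: sqr_ge0.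
move=> /allP /(_ j (mem_index_enum _)); rewrite implyTb sqrf_eq0.
by move/eqP.
Qed.

Lemma pinvP m n (A : 'M[K]_(m, n)) : is_pinv A (pinv A).
Proof.
apply: (@xgetPex _ 0 [set X | is_pinv A X]).
have [r [C [F [AE Cf Ff]]]] : exists r (C : 'M[K]_(m, r)) (F : 'M[K]_(r, n)),
    [/\ A = C *m F, row_full C & row_free F].
  exists (\rank A), (col_base A), (row_base A).
  by rewrite mulmx_base col_base_full row_base_free.
have FU : F *m F^T \in unitmx by exact: gram_unit.
have CU : C^T *m C \in unitmx.
  rewrite -{2}(trmxK C); apply: gram_unit.
  by rewrite /row_free mxrank_tr; exact: Cf.
pose Fi := F^T *m invmx (F *m F^T); pose Ci := invmx (C^T *m C) *m C^T.
have FFi : F *m Fi = 1%:M by rewrite mulmxA mulmxV.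
have CiC : Ci *m C = 1%:M by rewrite -mulmxA mulVmx.
have AX : A *m (Fi *m Ci) = C *m Ci.
  by rewrite AE -mulmxA (mulmxA F) FFi mul1mx.
have XA : Fi *m Ci *m A = Fi *m F.
  by rewrite AE -mulmxA (mulmxA Ci) CiC mul1mx.
exists (Fi *m Ci); split; rewrite ?AX ?XA.
- by rewrite AE -mulmxA (mulmxA Ci) CiC mul1mx.
- by rewrite -mulmxA (mulmxA F) FFi mul1mx.
- by rewrite /Ci !trmx_mul trmx_inv trmx_mul !trmxK mulmxA.
- by rewrite /Fi !trmx_mul trmx_inv trmx_mul !trmxK mulmxA.
Qed.

End MoorePenrose.

Section Analysis.
Context {K : realType} {m n : nat}.
Implicit Types (D : 'M[K]_(m, n)) (S : {set 'I_m}).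

Definition active_set D (f : 'cV[K]_n) : {set 'I_m} :=
  [set j | (D *m f) j 0 != 0]%SET.

Definition active_sets D : set {set 'I_m} :=
  [set S | exists f : 'cV[K]_n, S = active_set D f].

(* D_{-S}, the complementary rows being listed in increasing order *)
Definition drop_rows D S : 'M[K]_(#|~: S|, n) :=
  rowsub (fun i : 'I_#|~: S| => enum_val i) D.

(* [kermx] is the left kernel, whence the transpose *)
Definition null_dim D S : nat := \rank (kermx (drop_rows D S)^T).

Definition scaling_factor D S : K :=
  \big[Num.max/0]_(i < #|~: S|) norm_n (col i (pinv (drop_rows D S))).

(* fhat is one of the (possibly several) minimisers *)
Definition sqrt_analysis_estimate D (lambda0 : K) (Y fhat : 'cV[K]_n) : Prop :=
  forall f : 'cV[K]_n,
    norm_n (Y - fhat) + lambda0 * norm_1 (D *m fhat)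
    <= norm_n (Y - f) + lambda0 * norm_1 (D *m f).

End Analysis.

Section Noise.
Context {K : realType} {d : measure_display} {Omega : measurableType d}.
Variable P : probability Omega K.

Definition rvec n (X : 'I_n -> {RV P >-> K}) (w : Omega) : 'cV[K]_n :=
  \col_i X i w.

(* Taking some of the B i equal to setT gives the product rule for every
   subfamily. *)
Definition mutually_independent n (X : 'I_n -> {RV P >-> K}) : Prop :=
  forall B : 'I_n -> set K, (forall i, measurable (B i)) ->
    P (\bigcap_(i in [set: 'I_n]) (X i @^-1` B i)) =
    (\prod_(i < n) P (X i @^-1` B i))%E.

(* X ~ N_n(0, sigma^2 I_n); the second argument of [normal_prob] is the
   standard deviation *)
Definition isotropic_gaussian n (sigma : K) (X : 'I_n -> {RV P >-> K}) : Prop :=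
  (forall (i : 'I_n) (B : set K), measurable B ->
     distribution P (X i) B = normal_prob 0 sigma B) /\
  mutually_independent X.

End Noise.

(* Main.v *)
Require Import Defs.
From HB Require Import structures.
From mathcomp Require Import all_boot all_order all_algebra.
From mathcomp Require Import all_classical all_reals all_analysis.
From mathcomp Require Import perm measurable_realfun ring lra.

Import Order.TTheory GRing.Theory Num.Theory.
Import numFieldNormedType.Exports.

Local Open Scope classical_set_scope.
Local Open Scope ring_scope.

(** Notation: e is the noise, A is D_{-S}, A^+ its pseudoinverse, Q = 1 - A^+ A
    the orthogonal projection onto the null space of A, r the dimension of that
    null space and N = n - r the rank of A.

    Deterministic part ([residual_norm_close]).  By the triangle inequality it
    suffices that fhat lies within eta |e|_n of f0.  Otherwise the segment from
    f0 to fhat crosses the sphere of that radius at a point f0 + h, which by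
    convexity does at least as well as f0 in the penalised criterion.  Expanding
    |e - h|_n^2 there gives a contradiction once
    - |e|_n > sigma sqrt (1 - sqrt (8 a / n)),
    - |Q e|_n <= q |e|_n with q the quotient in the hypothesis on eta,
    - <e, A^+ A h> / n <= R |e|_n |D h|_1 for all h.
    The constant c is made for this: (c + 2)^2 - 4 = (eta / 2 - q)^2.

    The first two conditions are chi-square tails, each failing with probability
    at most exp (- a) ([gaussian_lower_tail], [gaussian_upper_tail]).  The upper
    tail needs the exponential moments of |Q e|^2 ([gaussian_proj_mgf]); they
    are computed without rotating e, by linearising one square at a time with
    an auxiliary normal variable.

    The third condition is the delicate one ([self_normalised_max]).  R only
    pays for log (2 N), but A may have many more rows than its rank, so a union
    bound over the rows is too expensive.  A near-extremal basis of the range of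
    A in the sense of Auerbach gives weights beta_i of total mass close to N with
    |(A h)_i| <= beta_i |A h|_1 for all h ([almost_auerbach]).  Thus the vector
    |(A h)_i| / |A h|_1 is a probability vector dominated by beta.  Let U_i be
    the inner product of e with the i-th column of A^+, divided by gamma and by
    the Euclidean norm of e.  By convexity of the exponential,
    sum_i |(A h)_i| |U_i| > lambda |A h|_1 forces
    sum_i beta_i 2 cosh (lambda U_i) >= exp (lambda^2), whatever h is.  As
    cosh (lambda U_i) has mean at most exp (lambda^2 / 2), Markov's inequality
    bounds the probability by about 2 N exp (- lambda^2 / 2), as if A had only N
    rows; the value of R corresponds to lambda^2 = n (2 log (2 N) + 2 t) / (n - 1).

    The bound on the mean of cosh (lambda U_i) ([sphere_mgf]) comes from the
    Gaussian moment generating function.  In <v, e> / sigma = U sqrt q, with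
    q = |e|^2 / (n sigma^2), the direction of e is independent of q, which has
    mean 1, and q |-> cosh (y sqrt q) is convex, so replacing q by 1 can only
    decrease the mean.  Independence of direction and radius is used in the
    form of a scaling identity ([gaussian_scale]): weighting the law of e by
    exp (- s |e|^2) has the same effect as rescaling e. *)

Set Implicit Arguments.
Unset Strict Implicit.
Unset Printing Implicit Defensive.

(** * The l1 norm and almost Auerbach bases *)

Section Auerbach.
Context {K : realType}.

Lemma norm_1Z n (c : K) (f : 'cV[K]_n) : norm_1 (c *: f) = `|c| * norm_1 f.
Proof. by rewrite /norm_1 mulr_sumr; apply: eq_bigr => i _; rewrite mxE normrM. Qed.

Lemma norm_1_ge0 n (f : 'cV[K]_n) : 0 <= norm_1 f.
Proof. by apply: sumr_ge0. Qed.

Lemma norm_1_entry n (f : 'cV[K]_n) i : `|f i 0| <= norm_1 f.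
Proof.
by rewrite /norm_1 (bigD1 i)//= lerDl sumr_ge0.
Qed.

Lemma norm_1_eq0 n (f : 'cV[K]_n) : norm_1 f = 0 -> f = 0.
Proof.
move=> f0; apply/colP => i; rewrite mxE; apply/eqP.
by rewrite -normr_le0 (le_trans (norm_1_entry f i))// f0.
Qed.

Lemma normr_det_le n (B : 'M[K]_n) (l : K) :
  (forall i j, `|B i j| <= l) -> `|\det B| <= (n`!)%:R * l ^+ n.
Proof.
move=> Bl; rewrite /determinant; apply: (le_trans (ler_norm_sum _ _ _)).
apply: (@le_trans _ _ (\sum_(s : 'S_n) l ^+ n)); last first.
  by rewrite sumr_const card_Sn mulr_natl.
apply: ler_sum => s _; rewrite normrMsign normr_prod.
rewrite -[X in l ^+ X]card_ord -prodr_const.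
by apply: ler_prod => i _; rewrite normr_ge0 Bl.
Qed.

Definition set_col n (k : 'I_n) (z : 'cV[K]_n) (B : 'M[K]_n) : 'M[K]_n :=
  \matrix_(i, j) if j == k then z i 0 else B i j.

Lemma det_set_col n (k : 'I_n) z (B : 'M[K]_n) :
  \det (set_col k z B) = (\adj B *m z) k 0.
Proof.
rewrite (expand_det_col _ k) mxE; apply: eq_bigr => i _.
rewrite !mxE eqxx mulrC; congr (_ * _).
rewrite /cofactor; congr (_ * \det _).
by apply/matrixP => a b; rewrite !mxE eq_sym (negbTE (neq_lift _ _)).
Qed.

(** Auerbach's argument.  Among the N-tuples of vectors in the unit ball of the
    range of C, take one whose determinant is within a factor 1 - delta of the
    supremum.  By Cramer's rule the coordinates of any vector of the ball with
    respect to it are quotients of two such determinants, hence at most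
    1 / (1 - delta), and beta_i collects the i-th entries of the basis vectors.
    Such a tuple exists because the determinants are bounded. *)
Lemma almost_auerbach_full M N (C : 'M[K]_(M, N)) (delta : K) :
  row_full C -> 0 < delta < 1 ->
  exists beta : 'I_M -> K, [/\ forall i, 0 <= beta i,
    \sum_i beta i <= N%:R / (1 - delta) &
    forall z : 'cV[K]_N, forall i, `|(C *m z) i 0| <= beta i * norm_1 (C *m z)].
Proof.
move=> /row_fullP[L LC] /andP[d0 d1].
have d1' : 0 < 1 - delta by rewrite subr_gt0.
pose V := [set r : K | exists2 B : 'M[K]_N,
   (forall k, norm_1 (C *m col k B) <= 1) & r = `|\det B|].
pose l := \sum_i \sum_j `|L i j|.
have l_ge i j : `|L i j| <= l.
  rewrite /l (bigD1 i)//= (bigD1 j)//= -addrA lerDl addr_ge0 ?sumr_ge0//.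
  by move=> *; apply: sumr_ge0.
have entry (z : 'cV[K]_N) j : norm_1 (C *m z) <= 1 -> `|z j 0| <= l.
  move=> z1; rewrite -[z]mul1mx -LC -mulmxA mxE.
  apply: (le_trans (ler_norm_sum _ _ _)).
  apply: (@le_trans _ _ (\sum_i l * `|(C *m z) i 0|)).
    by apply: ler_sum => i _; rewrite normrM ler_wpM2r.
  rewrite -mulr_sumr -[leRHS]mulr1 ler_wpM2l// /l.
  by apply: sumr_ge0 => *; apply: sumr_ge0.
have Vub r : V r -> r <= (N`!)%:R * l ^+ N.
  move=> [B B1 ->]; apply: normr_det_le => i j.
  by have := entry (col j B) i (B1 j); rewrite mxE.
have hubV : has_ubound V by exists ((N`!)%:R * l ^+ N) => r; exact: Vub.
(* A small multiple of the identity shows that the supremum is positive. *)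
pose c := (1 + \sum_i \sum_j `|C i j|)^-1.
have sC0 : 0 <= \sum_i \sum_j `|C i j|.
  by apply: sumr_ge0 => *; apply: sumr_ge0.
have c0 : 0 < c by rewrite invr_gt0 ltr_pwDl.
have Vc : V (c ^+ N).
  exists (c%:M); last by rewrite det_scalar ger0_norm// exprn_ge0// ltW.
  move=> k; rewrite -scalemx1.
  have -> : col k (c *: 1%:M) = c *: col k (1%:M : 'M[K]_N).
    by apply/colP => i; rewrite !mxE.
  rewrite -scalemxAr norm_1Z (gtr0_norm c0) mulrC ler_pdivrMr ?mul1r; last first.
    by rewrite ltr_pwDl.
  rewrite colE mulmxA -colE mulmx1 /norm_1 (@le_trans _ _ (\sum_i \sum_j `|C i j|))//.
    by apply: ler_sum => i _; rewrite mxE (bigD1 k)//= lerDl sumr_ge0.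
  by rewrite lerDr.
have s0 : 0 < sup V.
  by apply: (@lt_le_trans _ _ (c ^+ N)); [rewrite exprn_gt0|exact: ub_le_sup].
have hsV : has_sup V by split => //; exists (c ^+ N).
have [|_ [B B1 ->] Bdet] := @sup_adherent _ V (delta * sup V) _ hsV.
  by rewrite mulr_gt0.
have {}Bdet : (1 - delta) * sup V < `|\det B| by rewrite mulrBl mul1r.
have detB0 : 0 < `|\det B| by apply: lt_trans Bdet; rewrite mulr_gt0.
pose beta i := (\sum_k `|(C *m B) i k|) / (1 - delta).
have coord (z : 'cV[K]_N) k : norm_1 (C *m z) <= 1 ->
    `|(\adj B *m z) k 0| <= `|\det B| / (1 - delta).
  move=> z1; rewrite -det_set_col ler_pdivlMr// mulrC.
  apply: le_trans (ltW Bdet); rewrite ler_wpM2l ?(ltW d1')//.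
  apply: ub_le_sup => //; exists (set_col k z B) => // j.
  have [->|jk] := eqVneq j k.
    have -> : col k (set_col k z B) = z by apply/colP => i; rewrite !mxE eqxx.
    exact: z1.
  have -> : col j (set_col k z B) = col j B.
    by apply/colP => i; rewrite !mxE (negbTE jk).
  exact: B1.
have unit_bound (z : 'cV[K]_N) i : norm_1 (C *m z) <= 1 ->
    `|(C *m z) i 0| <= beta i.
  move=> z1; rewrite -(ler_pM2l detB0) -normrM.
  have -> : \det B * (C *m z) i 0 = (C *m B *m (\adj B *m z)) i 0.
    by rewrite mulmxA -(mulmxA C) mul_mx_adj mul_mx_scalar -scalemxAl [RHS]mxE.
  rewrite mxE; apply: (le_trans (ler_norm_sum _ _ _)).
  rewrite /beta mulrCA mulr_suml; apply: ler_sum => k _.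
  by rewrite normrM ler_wpM2l// coord.
exists beta; split.
- by move=> i; rewrite divr_ge0 ?(ltW d1')// sumr_ge0.
- rewrite /beta -mulr_suml ler_wpM2r ?invr_ge0 ?(ltW d1')//.
  rewrite exchange_big/= -[X in _ <= X%:R]card_ord -sumr_const.
  apply: ler_sum => k _; have := B1 k; rewrite colE mulmxA -colE; apply: le_trans.
  by rewrite /norm_1; under [leRHS]eq_bigr do rewrite mxE.
- move=> z i; have [z0|z0] := eqVneq (norm_1 (C *m z)) 0.
    by rewrite z0 mulr0 (norm_1_eq0 z0) mxE normr0.
  have zp : 0 < norm_1 (C *m z) by rewrite lt_neqAle eq_sym z0 norm_1_ge0.
  have := @unit_bound ((norm_1 (C *m z))^-1 *: z) i.
  rewrite -scalemxAr norm_1Z ger0_norm ?invr_ge0 ?(ltW zp)// mulVf// lexx.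
  move=> /(_ isT); rewrite mxE normrM ger0_norm ?invr_ge0 ?(ltW zp)//.
  by rewrite mulrC ler_pdivrMr.
Qed.

(** Expresses that the vectors |A h| / |A h|_1 are dominated by one measure of
    mass close to the rank of A, however many rows A has. *)
Lemma almost_auerbach M n (A : 'M[K]_(M, n)) (delta : K) :
  0 < delta < 1 ->
  exists beta : 'I_M -> K, [/\ forall i, 0 <= beta i,
    \sum_i beta i <= (\rank A)%:R / (1 - delta) &
    forall h : 'cV[K]_n, forall i, `|(A *m h) i 0| <= beta i * norm_1 (A *m h)].
Proof.
move=> /(almost_auerbach_full (col_base_full A))[beta [b0 bs bA]].
exists beta; split => // h i.
by rewrite -[A]mulmx_base -mulmxA; exact: bA.
Qed.

End Auerbach.

(** * Euclidean geometry and the deterministic argument *)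

Section Deterministic.
Context {K : realType}.

Definition dotp n (f g : 'cV[K]_n) : K := \sum_(i < n) f i 0 * g i 0.

Lemma dotpC n (f g : 'cV[K]_n) : dotp f g = dotp g f.
Proof. by apply: eq_bigr => i _; rewrite mulrC. Qed.

Lemma dotpDl n (f g h : 'cV[K]_n) : dotp (f + g) h = dotp f h + dotp g h.
Proof. by rewrite -big_split/=; apply: eq_bigr => i _; rewrite mxE mulrDl. Qed.

Lemma dotpZl n (c : K) (f h : 'cV[K]_n) : dotp (c *: f) h = c * dotp f h.
Proof. by rewrite mulr_sumr; apply: eq_bigr => i _; rewrite mxE mulrA. Qed.

Lemma dotpDr n (f g h : 'cV[K]_n) : dotp h (f + g) = dotp h f + dotp h g.
Proof. by rewrite dotpC dotpDl !(dotpC h). Qed.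

Lemma dotpZr n (c : K) (f h : 'cV[K]_n) : dotp h (c *: f) = c * dotp h f.
Proof. by rewrite dotpC dotpZl (dotpC h). Qed.

Lemma dotp0l n (f : 'cV[K]_n) : dotp 0 f = 0.
Proof. by rewrite /dotp big1// => i _; rewrite mxE mul0r. Qed.

Lemma dotpE n (f g : 'cV[K]_n) : dotp f g = (f^T *m g) 0 0.
Proof. by rewrite mxE; apply: eq_bigr => i _; rewrite mxE. Qed.

Lemma dotp_ge0 n (f : 'cV[K]_n) : 0 <= dotp f f.
Proof. by apply: sumr_ge0 => i _; rewrite -expr2 sqr_ge0. Qed.

Lemma dotp_eq0 n (f : 'cV[K]_n) : (dotp f f == 0) = (f == 0).
Proof.
apply/idP/eqP => [|->]; last first.
  by rewrite dotp0l.
rewrite psumr_eq0; last by move=> i _; rewrite -expr2 sqr_ge0.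
move=> /allP f0; apply/colP => i; rewrite mxE.
have := f0 i (mem_index_enum _); rewrite implyTb -expr2 sqrf_eq0.
by move/eqP.
Qed.

Lemma cauchy_schwarz n (f g : 'cV[K]_n) :
  dotp f g ^+ 2 <= dotp f f * dotp g g.
Proof.
have [->|g0] := eqVneq g 0.
  rewrite /dotp [X in X ^+ 2]big1 ?expr0n/=; last by move=> i _; rewrite mxE mulr0.
  by rewrite mulr_ge0 ?dotp_ge0.
have gp : 0 < dotp g g by rewrite lt_neqAle eq_sym dotp_eq0 g0 dotp_ge0.
have := dotp_ge0 (dotp g g *: f + (- dotp f g) *: g).
rewrite !(dotpDl, dotpDr, dotpZl, dotpZr) (dotpC g f) => H.
by rewrite -subr_ge0 -(pmulr_rge0 _ gp); apply: le_trans H _; rewrite le_eqVlt;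
  apply/orP; left; apply/eqP; ring.
Qed.

Lemma norm_nE n (f : 'cV[K]_n) : norm_n f = Num.sqrt (dotp f f / n%:R).
Proof. by congr (Num.sqrt (_ / _)); apply: eq_bigr => i _; rewrite expr2. Qed.

Lemma sqr_norm_n n (f : 'cV[K]_n) : norm_n f ^+ 2 = dotp f f / n%:R.
Proof. by rewrite norm_nE sqr_sqrtr// divr_ge0 ?dotp_ge0. Qed.

Lemma norm_n_ge0 n (f : 'cV[K]_n) : 0 <= norm_n f.
Proof. exact: sqrtr_ge0. Qed.

Lemma norm_nZ n (c : K) (f : 'cV[K]_n) : norm_n (c *: f) = `|c| * norm_n f.
Proof.
by rewrite !norm_nE dotpZl dotpZr mulrA -expr2 -mulrA sqrtrM ?sqr_ge0// sqrtr_sqr.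
Qed.

Lemma dotp_le n (f g : 'cV[K]_n) : dotp f g / n%:R <= norm_n f * norm_n g.
Proof.
apply: le_trans (ler_norm _) _.
rewrite -(ler_pXn2r (n := 2))// ?nnegrE ?mulr_ge0 ?norm_n_ge0//.
rewrite real_normK ?num_real// !exprMn !sqr_norm_n.
rewrite [leRHS]mulrACA -expr2 ler_wpM2r ?cauchy_schwarz//. 
Qed.

Lemma norm_nD n (f g : 'cV[K]_n) : norm_n (f + g) <= norm_n f + norm_n g.
Proof.
rewrite -(ler_pXn2r (n := 2))// ?nnegrE ?addr_ge0 ?norm_n_ge0//.
rewrite sqrrD !sqr_norm_n dotpDl !dotpDr (dotpC g f).
have := dotp_le f g.
rewrite !mulrDl -mulr_natl; lra.
Qed.

Lemma norm_1D n (f g : 'cV[K]_n) : norm_1 (f + g) <= norm_1 f + norm_1 g.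
Proof.
rewrite /norm_1 -big_split/=; apply: ler_sum => i _.
by rewrite mxE ler_normD.
Qed.

(** Convexity replaces a direct analysis of fhat: a lower bound on the residual
    norm is what lets R be absorbed by lambda0, and such a bound is available
    for free on the sphere of radius eta |e|_n around f0, though not at fhat.
    If fhat were outside that sphere, the point where the segment from f0 to
    fhat leaves it would satisfy eta^2 < eta^2. *)
Lemma residual_norm_close m n (D : 'M[K]_(m, n)) (f0 e fhat : 'cV[K]_n)
    (eta q c R lambda0 : K) :
  0 < eta < 1 -> 0 <= q -> 2 * q < eta ->
  c = Num.sqrt ((eta / 2 - q) ^+ 2 + 4) - 2 ->
  0 < norm_n e -> 0 < R -> R / (1 - eta) <= lambda0 ->
  lambda0 * norm_1 (D *m f0) <= c * norm_n e ->
  (forall h, dotp e h / n%:R <=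
     q * norm_n e * norm_n h + R * norm_n e * norm_1 (D *m h)) ->
  sqrt_analysis_estimate D lambda0 (f0 + e) fhat ->
  `| norm_n (f0 + e - fhat) / norm_n e - 1 | <= eta.
Proof.
move=> /andP[eta0 eta1] q0 q_eta cE e0 R0 Rl hf0 noise min_fhat.
have eta1' : 0 < 1 - eta by rewrite subr_gt0.
have l0 : 0 < lambda0 by apply: lt_le_trans Rl; rewrite divr_gt0.
have {}Rl : R <= lambda0 * (1 - eta) by rewrite -ler_pdivrMr.
have c2 : c ^+ 2 + 4 * c = (eta / 2 - q) ^+ 2.
  have : (c + 2) ^+ 2 = (eta / 2 - q) ^+ 2 + 4.
    by rewrite cE subrK sqr_sqrtr// addr_ge0 ?sqr_ge0.
  move=> H; have -> : c ^+ 2 + 4 * c = (c + 2) ^+ 2 - 4 by ring.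
  by rewrite H addrK.
have c0 : 0 <= c.
  rewrite cE subr_ge0 -[leLHS]ger0_norm// -sqrtr_sqr ler_sqrt.
    by have := sqr_ge0 (eta / 2 - q); lra.
  by rewrite addr_ge0 ?sqr_ge0.
pose h0 := fhat - f0.
have resE : f0 + e - fhat = e - h0 by rewrite /h0 opprB addrCA addrA.
rewrite resE.
have [small|large] := leP (norm_n h0) (eta * norm_n e).
  have t1 := norm_nD e (- h0); have t2 := norm_nD (e - h0) h0.
  have : norm_n (- h0) = norm_n h0 by rewrite -scaleN1r norm_nZ normrN1 mul1r.
  rewrite subrK in t2 => hN.
  rewrite -(ler_pM2r e0) -{2}[norm_n e]ger0_norm ?norm_n_ge0// -normrM mulrBl mul1r.
  rewrite mulfVK ?gt_eqF//; apply: le_trans small.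
  by rewrite ler_norml; apply/andP; split; lra.
(* fhat is too far away: move back along the segment to distance eta |e|_n. *)
exfalso.
have h0p : 0 < norm_n h0 by apply: lt_trans large; rewrite mulr_gt0.
pose al := eta * norm_n e / norm_n h0.
have al0 : 0 <= al by rewrite divr_ge0 ?mulr_ge0// ltW.
have al1 : 0 <= 1 - al by rewrite subr_ge0 ler_pdivrMr// mul1r ltW.
pose h := al *: h0.
have hE : norm_n h = eta * norm_n e.
  by rewrite norm_nZ ger0_norm// /al mulfVK// gt_eqF.
set E0 := norm_n e in e0 hf0 noise large al al0 al1 h hE *.
pose E := norm_n (e - h); pose p0 := norm_1 (D *m f0).
pose p := norm_1 (D *m (f0 + h)).
have p00 : 0 <= p0 by exact: norm_1_ge0.
have p_ge0 : 0 <= p by exact: norm_1_ge0.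
have convE : E <= (1 - al) * E0 + al * norm_n (e - h0).
  have -> : E = norm_n ((1 - al) *: e + al *: (e - h0)).
    congr norm_n; rewrite /h (scalerBr al e) addrA -scalerDl subrK scale1r//.
  by apply: le_trans (norm_nD _ _) _; rewrite !norm_nZ !ger0_norm.
have convp : p <= (1 - al) * p0 + al * norm_1 (D *m fhat).
  have -> : p = norm_1 ((1 - al) *: (D *m f0) + al *: (D *m fhat)).
    congr norm_1; rewrite mulmxDr /h -scalemxAr /h0 mulmxBr scalerBr scalerBl.
    by rewrite scale1r addrCA [RHS]addrC.
  by apply: le_trans (norm_1D _ _) _; rewrite !norm_1Z !ger0_norm.
clearbody h.
have minf0 : norm_n (e - h0) + lambda0 * norm_1 (D *m fhat) <= E0 + lambda0 * p0.
  by have := min_fhat f0; rewrite resE [f0 + e]addrC addrK.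
have basic : E + lambda0 * p <= E0 + lambda0 * p0.
  have a1 := ler_wpM2l (ltW l0) convp.
  have a2 := ler_wpM2l al0 minf0.
  by nra.
have Dh : norm_1 (D *m h) <= p + p0.
  have -> : D *m h = D *m (f0 + h) + (- 1) *: (D *m f0).
    by rewrite scaleN1r mulmxDr addrC addKr.
  by apply: le_trans (norm_1D _ _) _; rewrite norm_1Z normrN1 mul1r.
have Elow : (1 - eta) * E0 <= E.
  by have := norm_nD (e - h) h; rewrite subrK hE -/E0 -/E; lra.
have E2 : E ^+ 2 = E0 ^+ 2 - 2 * (dotp e h / n%:R) + (eta * E0) ^+ 2.
  rewrite -hE !sqr_norm_n -scaleN1r !(dotpDl, dotpDr, dotpZl, dotpZr) (dotpC h e).
  by ring.
have := noise h; rewrite hE -/E0.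
set x := dotp e h / n%:R in E2 * => xle.
pose w := lambda0 * p; pose w0 := lambda0 * p0.
have w_ge0 : 0 <= w by rewrite mulr_ge0 ?(ltW l0).
have w0_ge0 : 0 <= w0 by rewrite mulr_ge0 ?(ltW l0).
have RDh : R * E0 * norm_1 (D *m h) <= (1 - eta) * E0 * (w + w0).
  rewrite -mulrDr mulrA [leRHS]mulrC -!mulrA.
  apply: (@le_trans _ _ (R * (E0 * (p + p0)))).
    by rewrite ler_wpM2l ?(ltW R0)// ler_wpM2l// ltW.
  have : 0 <= E0 * (p + p0) by rewrite mulr_ge0 ?addr_ge0// ltW.
  by move=> ge; have := ler_wpM2r ge Rl; nra.
have {}xle : x <= q * eta * E0 ^+ 2 + (1 - eta) * E0 * (w + w0).
  by apply: le_trans xle _; rewrite lerD// le_eqVlt; apply/orP; left; apply/eqP; ring.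
have s1 : E ^+ 2 - E0 ^+ 2 <= (w0 - w) * (E + E0).
  have EE0 : 0 <= E + E0 by rewrite addr_ge0 ?norm_n_ge0.
  rewrite subr_sqr ler_wpM2r//.
  by move: basic; rewrite -/w -/w0; lra.
(* Here R <= (1 - eta) lambda0 pays off: the penalty of f0 + h drops out. *)
have wneg : 0 <= w * (E + E0 - 2 * (1 - eta) * E0).
  rewrite mulr_ge0//.
  have : 0 <= eta * E0 by rewrite mulr_ge0 ?ltW.
  by nra.
have w0le : w0 <= c * E0 by [].
have Eup : E <= (1 + c) * E0.
  by move: basic; rewrite -/w -/w0; lra.
have s2 : w0 * (E + E0 + 2 * (1 - eta) * E0) <=
    c * E0 * ((1 + c) * E0 + E0 + 2 * (1 - eta) * E0).
  apply: ler_pM => //; last lra.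
  by have := mulr_ge0 (ltW eta1') (ltW e0); have := norm_n_ge0 (e - h); rewrite -/E; lra.
have final : eta ^+ 2 * E0 ^+ 2 <= ((eta / 2 + q) ^+ 2 - 2 * eta * c) * E0 ^+ 2.
  have -> : (eta / 2 + q) ^+ 2 = (eta / 2 - q) ^+ 2 + 2 * q * eta by field.
  rewrite -c2; nra.
have E02 : 0 < E0 ^+ 2 by rewrite exprn_gt0.
rewrite ler_pM2r// in final.
have : 0 <= eta * c by rewrite mulr_ge0 ?(ltW eta0).
nra.
Qed.

End Deterministic.

(** * Integrals determined by weighted laws *)

Section Transfer.
Context {K : realType}.
Local Open Scope ereal_scope.

Import HBNNSimple.

Section weighted.
Context d d' (T : measurableType d) (T' : measurableType d').
Variables (m : {measure set T -> \bar K}) (X : T -> T') (Z : T -> K).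
Hypotheses (mX : measurable_fun setT X) (mZ : measurable_fun setT Z).
Hypothesis Z0 : forall x, (0 <= Z x)%R.

Definition weighted_law (B : set T') : \bar K := \int[m]_(x in X @^-1` B) (Z x)%:E.

(** The right-hand side depends on m, X and Z through the weighted law of X
    only, so that integrals over different spaces become comparable. *)
Lemma weighted_integral_lim (f : T' -> \bar K) (mf : measurable_fun setT f) :
  (forall y, 0 <= f y) ->
  \int[m]_x ((Z x)%:E * f (X x)) =
  limn (fun n => \sum_(k \in range (nnsfun_approx measurableT mf n))
    (k%:E * weighted_law (nnsfun_approx measurableT mf n @^-1` [set k]))).
Proof.
move=> f0; pose f_ := nnsfun_approx measurableT mf.
have mfX n : measurable_fun setT (fun x => f_ n (X x)) by apply: measurableT_comp.
transitivity (limn (fun n => \int[m]_x ((Z x)%:E * (f_ n (X x))%:E))).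
  rewrite -monotone_convergence//.
  - apply: eq_integral => x _; apply/esym/cvg_lim => //.
    by apply: cvgeZl => //; apply: (cvg_nnsfun_approx measurableT mf).
  - by move=> n; apply/measurable_EFinP; apply: measurable_funM.
  - by move=> n x _; rewrite lee_fin mulr_ge0.
  - by move=> x _ a b ab; rewrite lee_fin ler_wpM2l//; exact/lefP/nd_nnsfun_approx.
congr (limn _); apply/funext => n.
rewrite -/(f_ n).
have mS k : measurable (X @^-1` (f_ n @^-1` [set k])).
  by rewrite -[X in measurable X]setTI; exact: mX.
have ptE k x : (Z x * (k * \1_(f_ n @^-1` [set k]) (X x)))%:E =
    k%:E * ((EFin \o Z) \_ (X @^-1` (f_ n @^-1` [set k]))) x.
  rewrite epatch_indic/= -!EFinM mulrCA; congr (_ * (_ * _))%:E.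
have pt0 k x : 0 <= k%:E * ((EFin \o Z) \_ (X @^-1` (f_ n @^-1` [set k]))) x.
  rewrite patchE; case: ifPn => [|_]; last by rewrite mule0.
  rewrite inE /= => <-; rewrite lee_fin mulr_ge0//.
have mpt k : measurable_fun setT
    (fun x => k%:E * ((EFin \o Z) \_ (X @^-1` (f_ n @^-1` [set k]))) x).
  apply: measurable_funeM; apply/(measurable_restrictT _ (mS k)).1.
  by apply/measurable_EFinP; exact: measurable_funTS.
under eq_integral => x _.
  rewrite -EFinM fimfunE mulr_fsumr -fsumEFin//.
  under eq_fsbigr do rewrite ptE.
  over.
rewrite ge0_integral_fsum//.
apply: eq_fsbigr => k; rewrite inE => -[x0 _ kE].
rewrite ge0_integralZl_EFin//.
- by rewrite /weighted_law [in RHS]integral_mkcond.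
- by move=> x _; rewrite patchE; case: ifP => // _; rewrite lee_fin.
- apply/(measurable_restrictT _ (mS k)).1.
  by apply/measurable_EFinP; exact: measurable_funTS.
- by rewrite -kE.
Qed.

End weighted.

(** Passes from events to nonnegative functions.  With constant weights it is
    the change of variables formula; with a density as weight it also covers
    changes of measure, which is how densities, tilted laws and independence
    are handled below. *)
Lemma ge0_integral_transfer d1 d2 d' (T1 : measurableType d1)
    (T2 : measurableType d2) (T' : measurableType d')
    (m1 : {measure set T1 -> \bar K}) (m2 : {measure set T2 -> \bar K})
    (X1 : T1 -> T') (X2 : T2 -> T') (Z1 : T1 -> K) (Z2 : T2 -> K)
    (f : T' -> \bar K) :
  measurable_fun setT X1 -> measurable_fun setT X2 ->
  measurable_fun setT Z1 -> measurable_fun setT Z2 ->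
  (forall x, (0 <= Z1 x)%R) -> (forall x, (0 <= Z2 x)%R) ->
  (forall B, measurable B ->
    \int[m1]_(x in X1 @^-1` B) (Z1 x)%:E = \int[m2]_(x in X2 @^-1` B) (Z2 x)%:E) ->
  measurable_fun setT f -> (forall y, 0 <= f y) ->
  \int[m1]_x ((Z1 x)%:E * f (X1 x)) = \int[m2]_x ((Z2 x)%:E * f (X2 x)).
Proof.
move=> mX1 mX2 mZ1 mZ2 Z10 Z20 eqB mf f0.
rewrite !(weighted_integral_lim _ _ _ _ mf)//.
congr (limn _); apply/funext => n; apply: eq_fsbigr => k _.
by congr (_ * _); rewrite /weighted_law eqB//.
Qed.

End Transfer.

(** * Products of functions of independent variables *)

Section Independence.
Context {K : realType} {d : measure_display} {Omega : measurableType d}.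
Variable P : probability Omega K.

Lemma measurable_preimage_RV (X : {RV P >-> K}) B :
  measurable B -> measurable (X @^-1` B).
Proof.
by move=> mB; rewrite -[X in measurable X]setTI; exact: measurable_funPT.
Qed.

Lemma integral_indic_RV (X : {RV P >-> K}) B : measurable B ->
  (\int[P]_w (\1_B (X w))%:E = P (X @^-1` B))%E.
Proof.
move=> mB; have -> : (fun w => (\1_B (X w))%:E) = (fun w => (\1_(X @^-1` B) w)%:E :> \bar K).
  by apply/funext.
by rewrite integral_indic ?setIT//; exact: measurable_preimage_RV.
Qed.

(** The indicators of the product rule are replaced by the functions f i one
    index at a time: with the other factors frozen into a weight Z, the product
    rule for the remaining index says that its weighted law is a multiple of
    its law, and the transfer principle goes from indicators to f i. *)
Lemma indep_integral_prod n (X : 'I_n -> {RV P >-> K}) (f : 'I_n -> K -> K)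
    (e : 'I_n -> K) :
  mutually_independent X ->
  (forall i, measurable_fun setT (f i)) -> (forall i x, 0 <= f i x) ->
  (forall i, \int[P]_w (f i (X i w))%:E = (e i)%:E)%E ->
  (\int[P]_w (\prod_i f i (X i w))%:E = (\prod_i e i)%:E)%E.
Proof.
move=> indep.
suff H k : (k <= n)%N -> forall (f : 'I_n -> K -> K) (e : 'I_n -> K),
    (forall i, measurable_fun setT (f i)) -> (forall i x, 0 <= f i x) ->
    (forall i, \int[P]_w (f i (X i w))%:E = (e i)%:E)%E ->
    (forall i : 'I_n, (k <= i)%N -> exists2 B, measurable B & f i = \1_B) ->
    (\int[P]_w (\prod_i f i (X i w))%:E = (\prod_i e i)%:E)%E.
  move=> mf f0 fe; apply: (H n) => // i; rewrite leqNgt ltn_ord//.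
elim: k => [_|k IH kn] {}f {}e mf f0 fe fB.
  have /choice[B HB] : forall i, exists B, measurable B /\ f i = \1_B.
    by move=> i; have [//|B mB fE] := fB i; exists B.
  have mXB i : measurable (X i @^-1` B i).
    by apply: measurable_preimage_RV; case: (HB i).
  have eE i : P (X i @^-1` B i) = (e i)%:E.
    by rewrite -fe (HB i).2 integral_indic_RV//; case: (HB i).
  have := indep B (fun i => (HB i).1).
  rewrite (eq_bigr (fun i => (e i)%:E)); last by move=> i _; exact: eE.
  rewrite prodEFin => <-.
  have mcap : measurable (\bigcap_(i in [set: 'I_n]) (X i @^-1` B i)).
    by apply: fin_bigcap_measurable => //; exact: finite_finset.
  rewrite -[X in _ = P X]setIT -integral_indic//.
  apply: eq_integral => w _; congr EFin.
  rewrite indicE; have [/set_mem wB|wB] := boolP (w \in _).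
    by rewrite big1// => i _; rewrite (HB i).2 indicE mem_set//; exact: wB.
  have [i wBi] : exists i, ~ B i (X i w).
    by apply/existsNP => wBi; move: wB; rewrite notin_setE; apply => i _; exact: wBi.
  by rewrite (bigD1 i)//= (HB i).2 indicE memNset// mul0r.
pose k0 := Ordinal kn.
pose Z w := \prod_(i | i != k0) f i (X i w).
pose c := \prod_(i | i != k0) e i.
have Z0 w : 0 <= Z w by apply: prodr_ge0.
have c0 : 0 <= c.
  apply: prodr_ge0 => i _; rewrite -lee_fin -fe.
  by apply: integral_ge0 => w _; rewrite lee_fin.
have mZ : measurable_fun setT Z.
  rewrite /Z; under eq_fun do rewrite -big_filter.
  by apply: measurable_prod => i _; apply: measurableT_comp.
have split w : \prod_i f i (X i w) = Z w * f k0 (X k0 w).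
  by rewrite (bigD1 k0)//= mulrC.
under eq_integral do rewrite split EFinM.
rewrite (@ge0_integral_transfer _ _ _ _ _ _ _ P P (X k0) (X k0) Z (cst c)
  (EFin \o f k0))//=.
- rewrite ge0_integralZl_EFin//.
  + by rewrite fe -EFinM (bigD1 k0)//= mulrC.
  + by move=> w _; rewrite lee_fin.
  + by apply/measurable_EFinP; apply: measurableT_comp.
- move=> B mB; pose g i := if i == k0 then \1_B else f i.
  pose e' i := if i == k0 then fine (P (X k0 @^-1` B)) else e i.
  have mXB : measurable (X k0 @^-1` B).
    exact: measurable_preimage_RV.
  have := IH (ltnW kn) g e'.
  rewrite (bigD1 k0)//= /e' eqxx (eq_bigr e); last by move=> i /negbTE ->.
  rewrite -/c => H.
  rewrite integral_cst//  -[X in (_ * X)%E]fineK ?fin_num_measure// -EFinM mulrC -H.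
  + rewrite integral_mkcond; apply: eq_integral => w _.
    rewrite (bigD1 k0)//= /g eqxx (eq_bigr (fun i => f i (X i w))); last first.
      by move=> i /negbTE ->.
    rewrite -/(Z w) epatch_indic/= -EFinM mulrC; congr (_ * _)%:E.
  + by move=> i; rewrite /g; case: ifP => // _; exact: measurable_indic.
  + by move=> i x; rewrite /g; case: ifP.
  + move=> i; rewrite /g; case: eqP => [->|//].
    by rewrite fineK ?fin_num_measure// integral_indic_RV.
  + move=> i ki; rewrite /g; case: eqP => [_|ik]; first by exists B.
    apply: fB; rewrite ltn_neqAle ki andbT; apply/eqP => kiE; apply: ik.
    by apply/val_inj.
- by apply/measurable_EFinP.
- by move=> y; rewrite lee_fin.
Qed.

End Independence.

(** * The normal distribution on the line *)

Section Normal.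
Context {K : realType}.

(** Completing the square: an exponential of a quadratic polynomial turns a
    normal density into a multiple of another one. *)
Lemma normal_pdf_tilt (sigma b s x : K) (tau := 1 + 2 * s * sigma ^+ 2) :
  0 < sigma -> 0 < tau ->
  normal_pdf 0 sigma x * expR (b * x - s * x ^+ 2) =
  expR (b ^+ 2 * sigma ^+ 2 / (2 * tau)) / Num.sqrt tau *
    normal_pdf (b * sigma ^+ 2 / tau) (sigma / Num.sqrt tau) x.
Proof.
move=> s0 t0.
have st0 : 0 < Num.sqrt tau by rewrite sqrtr_gt0.
have ss0 : 0 < sigma / Num.sqrt tau by rewrite divr_gt0.
have sE : s = (tau - 1) / (2 * sigma ^+ 2).
  by rewrite /tau; field; rewrite gt_eqF.
clearbody tau; rewrite {s}sE.
rewrite !normal_pdfE ?gt_eqF// /normal_fun /normal_peak.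
rewrite expr_div_n sqr_sqrtr ?(ltW t0)//.
have -> : Num.sqrt (sigma ^+ 2 / tau * pi *+ 2) =
    Num.sqrt (sigma ^+ 2 * pi *+ 2) / Num.sqrt tau.
  rewrite -sqrtrV ?(ltW t0)// -sqrtrM.
    by congr Num.sqrt; rewrite !mulr2n; ring.
  by rewrite mulrn_wge0// mulr_ge0 ?sqr_ge0// ltW// pi_gt0.
have expE : - (x - 0) ^+ 2 / (sigma ^+ 2 *+ 2) +
    (b * x - (tau - 1) / (2 * sigma ^+ 2) * x ^+ 2) =
   b ^+ 2 * sigma ^+ 2 / (2 * tau) +
   - (x - b * sigma ^+ 2 / tau) ^+ 2 / (sigma ^+ 2 / tau *+ 2).
  by rewrite !mulr2n; field; rewrite !gt_eqF ?addr_gt0 ?exprn_gt0.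
rewrite -[LHS]mulrA -expRD expE expRD.
have : Num.sqrt tau != 0 by rewrite gt_eqF.
have : Num.sqrt (sigma ^+ 2 * pi *+ 2) != 0.
  by rewrite gt_eqF// sqrtr_gt0 mulrn_wgt0// mulr_gt0 ?exprn_gt0 ?pi_gt0.
move: (Num.sqrt tau) (Num.sqrt _) (expR _) (expR _) => S T E1 E2 Tn0 Sn0.
by field; rewrite Sn0 Tn0.
Qed.

Lemma measurable_normal_pdf_patch (m s : K) (D : set K) : measurable D ->
  measurable_fun setT ((fun x => (normal_pdf m s x)%:E) \_ D).
Proof.
move=> mD; apply: (iffLR (measurable_restrictT _ mD)).
have mpdf : measurable_fun D (EFin \o normal_pdf m s).
  apply/measurable_EFinP; apply: measurable_funTS.
  exact: (measurable_normal_pdf m s).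
exact: mpdf.
Qed.

Lemma normal_pdf_patch_ge0 (m s : K) (D : set K) x :
  (0 <= ((fun x => (normal_pdf m s x)%:E) \_ D) x)%E.
Proof. by rewrite patchE; case: ifP => // _; rewrite lee_fin normal_pdf_ge0. Qed.

Lemma measurable_exp_quad (b s : K) :
  measurable_fun setT (fun x : K => expR (b * x - s * x ^+ 2)).
Proof.
apply: measurableT_comp => //; apply: measurable_funB => //.
exact: measurable_funM.
Qed.

Lemma ge0_integral_scale (r : K) (f : K -> \bar K) : 0 < r ->
  measurable_fun setT f -> (forall x, 0 <= f x)%E ->
  (\int[lebesgue_measure]_x f x =
   r%:E * \int[lebesgue_measure]_x f (r * x)%R)%E.
Proof.
move=> r0 mf f0.
pose scale : measurableTypeR K -> measurableTypeR K := fun x => r * x.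
have mscl : measurable_fun setT scale by exact: measurable_funM.
pose r' : {nonneg K} := NngNum (ltW r0).
have muE (A : set (measurableTypeR K)) : measurable A ->
    (lebesgue_measure A = r%:E * lebesgue_measure (scale @^-1` A))%E.
  have unique := @lebesgue_measure_unique K
    (mscale r' (pushforward lebesgue_measure scale)).
  apply: (unique mscl) => {unique}.
  move=> _ [[a b] _ <-].
  change (lebesgue_measure `]a, b]%classic =
    (r%:E * lebesgue_measure (scale @^-1` `]a, b]%classic))%E).
  have -> : scale @^-1` `]a, b]%classic = `]a / r, b / r]%classic.
    apply/seteqP; split => x /=; rewrite /scale !in_itv/= ltr_pdivrMr// ler_pdivlMr//;
      by rewrite mulrC.
  rewrite !lebesgue_measure_itv/= !lte_fin ltr_pM2r ?invr_gt0//.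
  case: ifP => _; last by rewrite mule0.
  by rewrite -!EFinB -EFinM -mulrBl mulrC divfK// gt_eqF.
have := @ge0_integral_transfer K _ _ _ _ _ _ lebesgue_measure lebesgue_measure
  (@idfun (measurableTypeR K)) scale (cst 1) (cst r) f.
under eq_integral do rewrite mul1e.
move=> ->//=.
- rewrite ge0_integralZl_EFin ?(ltW r0)//.
  by apply: (measurableT_comp mf).
- exact: measurable_id.
- by move=> _; exact: ltW.
- move=> B mB; rewrite !integral_cst//=.
    by rewrite mul1e muE.
  by rewrite -[X in measurable X]setTI; exact: mscl.
Qed.

End Normal.

Section NormalRV.
Context {K : realType} {d : measure_display} {Omega : measurableType d}.
Variable P : probability Omega K.
Variables (sigma : K) (X : {RV P >-> K}).
Hypothesis sigma0 : 0 < sigma.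
Hypothesis X_normal : forall B : set K, measurable B ->
  distribution P X B = normal_prob 0 sigma B.

Lemma expectation_normal (f : K -> K) :
  measurable_fun setT f -> (forall x, 0 <= f x) ->
  (\int[P]_w (f (X w))%:E =
   \int[lebesgue_measure]_x (normal_pdf 0 sigma x * f x)%:E)%E.
Proof.
move=> mf f0.
transitivity (\int[P]_w ((cst 1 w : K)%:E * (EFin \o f) (X w))%E)%E.
  by apply: eq_integral => w _; rewrite /= mul1e.
rewrite (@ge0_integral_transfer K _ _ _ _ _ _ P lebesgue_measure X (@idfun K)
  (cst 1) (normal_pdf 0 sigma) (EFin \o f))//=.
- exact: measurable_id.
- exact: measurable_normal_pdf.
- by move=> x; exact: normal_pdf_ge0.
- move=> B mB; rewrite integral_cst// ?mul1e; last exact: measurable_preimage_RV.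
  exact: X_normal.
- exact/measurable_EFinP.
Qed.

(** B = setT gives the exponential moments; b = 0 says that the weight
    exp (- s x^2) changes the variance from sigma^2 to sigma^2 / tau. *)
Lemma expectation_normal_tilt (b s : K) (B : set K) (tau := 1 + 2 * s * sigma ^+ 2) :
  measurable B -> 0 < tau ->
  (\int[P]_w (\1_B (X w) * expR (b * X w - s * X w ^+ 2))%:E =
   (expR (b ^+ 2 * sigma ^+ 2 / (2 * tau)) / Num.sqrt tau)%:E *
    normal_prob (b * sigma ^+ 2 / tau) (sigma / Num.sqrt tau) B)%E.
Proof.
move=> mB t0.
have mexp := measurable_exp_quad b s.
rewrite (@expectation_normal (fun x => \1_B x * expR (b * x - s * x ^+ 2))).
- rewrite /normal_prob [X in (_ * X)%E]integral_mkcond -ge0_integralZl_EFin//.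
  + apply: eq_integral => x _.
    rewrite epatch_indic/= -!EFinM mulrCA normal_pdf_tilt// -/tau.
    by rewrite mulrC mulrA.
  + by move=> x _; exact: normal_pdf_patch_ge0.
  + exact: measurable_normal_pdf_patch.
- by apply: measurable_funM => //; exact: measurable_indic.
- by move=> x; rewrite mulr_ge0 ?expR_ge0.
Qed.

Lemma normal_scale (r : K) (B : set K) : 0 < r -> measurable B ->
  P ((fun w => X w / r) @^-1` B) = normal_prob 0 (sigma / r) B.
Proof.
move=> r0 mB.
have mBr : measurable ((fun x : K => x / r) @^-1` B).
  rewrite -[X in measurable X]setTI.
  by apply: (measurable_funM (f := id)).
transitivity (normal_prob 0 sigma ((fun x : K => x / r) @^-1` B)).
  by rewrite -X_normal.
rewrite /normal_prob integral_mkcond (@ge0_integral_scale _ r)//; last first.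
- by move=> x; exact: normal_pdf_patch_ge0.
- exact: measurable_normal_pdf_patch.
rewrite [RHS]integral_mkcond -ge0_integralZl_EFin ?(ltW r0)//; last first.
- apply: (measurableT_comp (measurable_normal_pdf_patch 0 sigma mBr)).
  exact: measurable_funM.
- by move=> x _; exact: normal_pdf_patch_ge0.
apply: eq_integral => y _.
rewrite !epatch_indic/= -!EFinM mulrA; congr (_ * _)%:E.
  rewrite !normal_pdfE ?gt_eqF ?divr_gt0// /normal_fun /normal_peak mulrA.
  congr (_ * expR _); last first.
    by rewrite !subr0 !mulr2n; field; rewrite !gt_eqF ?addr_gt0 ?exprn_gt0.
  rewrite expr_div_n.
  have -> : sigma ^+ 2 / r ^+ 2 * pi *+ 2 = (sigma ^+ 2 * pi *+ 2) / r ^+ 2.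
    by rewrite !mulr2n; ring.
  rewrite sqrtrM; last by rewrite mulrn_wge0// mulr_ge0 ?sqr_ge0// ltW// pi_gt0.
  by rewrite sqrtrV ?sqr_ge0// sqrtr_sqr gtr0_norm// invfM invrK mulrC.
rewrite !indicE; congr (nat_of_bool _)%:R.
have yE : r * y / r = y by rewrite mulrC mulKf ?gt_eqF.
by apply/idP/idP; rewrite !inE/= yE.
Qed.

End NormalRV.

(** * Laws of tuples *)

Section Boxes.
Context {K : realType}.

Definition box n (B : 'I_n -> set K) : set (n.-tuple K) :=
  [set t | forall i, B i (tnth t i)].

Definition boxes n : set (set (n.-tuple K)) :=
  [set E | exists2 B : 'I_n -> set K, (forall i, measurable (B i)) & E = box B].

Lemma measurable_box n (B : 'I_n -> set K) :
  (forall i, measurable (B i)) -> measurable (box B).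
Proof.
move=> mB; rewrite (_ : box B = \bigcap_(i in [set: 'I_n]) ((@tnth n K ^~ i) @^-1` B i)).
  apply: fin_bigcap_measurable; first exact: finite_finset.
  by move=> i _; rewrite -[X in measurable X]setTI; apply: measurable_tnth.
by apply/seteqP; split => [t tB i _|t tB i]; exact: tB.
Qed.

Lemma measurable_sigma_boxes n (E : set (n.-tuple K)) :
  measurable E -> <<s @boxes n >> E.
Proof.
rewrite /measurable/= /g_sigma_preimage.
apply: smallest_sub; first exact: smallest_sigma_algebra.
move=> A; rewrite -bigcup_seq => -[i /= _] [B mB <-].
apply: sub_sigma_algebra; exists (fun j => if j == i then B else setT).
  by move=> j; case: ifP.
apply/seteqP; split => [t [_ tB] j|t tB] /=.
  by case: eqP => [->|].
by split => //; have := tB i; rewrite eqxx.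
Qed.

Lemma weighted_law_sigma_additive d d' (T : measurableType d) (T' : measurableType d')
    (m : {measure set T -> \bar K}) (X : T -> T') (Z : T -> K) :
  measurable_fun setT X -> measurable_fun setT Z -> (forall x, 0 <= Z x) ->
  semi_sigma_additive (weighted_law m X Z).
Proof.
move=> mX mZ Z0 F mF tF mUF; rewrite /weighted_law preimage_bigcup.
apply: (@semi_sigma_additive_nng_induced _ _ _ m (EFin \o Z)).
- exact/measurable_EFinP.
- by move=> x; rewrite lee_fin.
- by move=> i; rewrite -[X in measurable X]setTI; exact: mX.
- apply/trivIsetP => i j _ _ ij; rewrite -preimage_setI.
  by move/trivIsetP : tF => /(_ _ _ _ _ ij) ->//; rewrite preimage_set0.
- apply: bigcupT_measurable => i.
  by rewrite -[X in measurable X]setTI; exact: mX.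
Qed.

(** Boxes are stable under intersection and generate the sigma-algebra of
    tuples, hence they determine weighted laws of finite mass. *)
Lemma weighted_law_unique d1 d2 (T1 : measurableType d1) (T2 : measurableType d2)
    n (m1 : {measure set T1 -> \bar K}) (m2 : {measure set T2 -> \bar K})
    (X1 : T1 -> n.-tuple K) (X2 : T2 -> n.-tuple K) (Z1 : T1 -> K) (Z2 : T2 -> K) :
  measurable_fun setT X1 -> measurable_fun setT X2 ->
  measurable_fun setT Z1 -> measurable_fun setT Z2 ->
  (forall x, 0 <= Z1 x) -> (forall x, 0 <= Z2 x) ->
  (\int[m1]_x (Z1 x)%:E < +oo)%E ->
  (forall B, (forall i, measurable (B i)) ->
     weighted_law m1 X1 Z1 (box B) = weighted_law m2 X2 Z2 (box B)) ->
  forall B, measurable B -> weighted_law m1 X1 Z1 B = weighted_law m2 X2 Z2 B.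
Proof.
move=> mX1 mX2 mZ1 mZ2 Z10 Z20 fin eqbox B mB.
have ge0 d (T : measurableType d) m (X : T -> n.-tuple K) (Z : T -> K) :
    (forall x, 0 <= Z x) -> forall A, (0 <= weighted_law m X Z A)%E.
  by move=> Z0 A; apply: integral_ge0 => x _; rewrite lee_fin.
have set00 d (T : measurableType d) m (X : T -> n.-tuple K) (Z : T -> K) :
    weighted_law m X Z set0 = 0%E.
  by rewrite /weighted_law preimage_set0 integral_set0.
pose mix1 := isMeasure.Build _ _ _ _ (set00 _ _ m1 X1 Z1) (ge0 _ _ m1 X1 Z1 Z10)
  (weighted_law_sigma_additive (m := m1) mX1 mZ1 Z10).
pose mix2 := isMeasure.Build _ _ _ _ (set00 _ _ m2 X2 Z2) (ge0 _ _ m2 X2 Z2 Z20)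
  (weighted_law_sigma_additive (m := m2) mX2 mZ2 Z20).
pose mu1 : {measure set (n.-tuple K) -> \bar K} := HB.pack (weighted_law m1 X1 Z1) mix1.
pose mu2 : {measure set (n.-tuple K) -> \bar K} := HB.pack (weighted_law m2 X2 Z2) mix2.
have boxT : setT = box (fun=> setT) :> set (n.-tuple K) by apply/seteqP.
apply: (@g_sigma_algebra_measure_unique _ _ _ (@boxes n) _ (fun=> setT) _ _ mu1 mu2).
- by move=> _ [C mC ->]; exact: measurable_box.
- by move=> _; exists (fun=> setT).
- by rewrite bigcup_const.
- move=> _ _ [C mC ->] [C' mC' ->]; exists (fun i => C i `&` C' i).
    by move=> i; exact: measurableI.
  by apply/seteqP; split => [t [tC tC'] i|t tCC']; [|split => i; case: (tCC' i)].
- by move=> _ [C mC ->]; exact: eqbox.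
- by move=> _; rewrite /mu1/= /weighted_law preimage_setT.
- exact: measurable_sigma_boxes.
Qed.

End Boxes.

(** * Tilting and rescaling Gaussian vectors *)

Section GaussianVector.
Context {K : realType} {d : measure_display} {Omega : measurableType d}.
Variables (P : probability Omega K) (n : nat) (sigma : K).
Variable eps : 'I_n -> {RV P >-> K}.
Hypothesis sigma0 : 0 < sigma.
Hypothesis gauss : isotropic_gaussian sigma eps.

Lemma dotp_rvec b w : dotp b (rvec eps w) = \sum_i b i 0 * eps i w.
Proof. by apply: eq_bigr => i _; rewrite mxE. Qed.

Lemma sqr_rvec w : dotp (rvec eps w) (rvec eps w) = \sum_i eps i w ^+ 2.
Proof. by apply: eq_bigr => i _; rewrite !mxE expr2. Qed.

Lemma measurable_dotp_rvec b : measurable_fun setT (fun w => dotp b (rvec eps w)).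
Proof.
under eq_fun do rewrite dotp_rvec.
by apply: measurable_sum => i; apply: measurable_funM.
Qed.

Lemma measurable_sqr_rvec :
  measurable_fun setT (fun w => dotp (rvec eps w) (rvec eps w)).
Proof.
under eq_fun do rewrite sqr_rvec.
by apply: measurable_sum => i; apply: measurable_funX.
Qed.

Lemma prod_expR_tilt (b : 'cV[K]_n) s w : \prod_i expR (b i 0 * eps i w - s * eps i w ^+ 2) =
  expR (dotp b (rvec eps w) - s * dotp (rvec eps w) (rvec eps w)).
Proof. by rewrite -expR_sum sumrB -mulr_sumr dotp_rvec sqr_rvec. Qed.

Lemma measurable_tilt (b : 'cV[K]_n) s : measurable_fun setT (fun w =>
  expR (dotp b (rvec eps w) - s * dotp (rvec eps w) (rvec eps w))).
Proof.
apply: measurableT_comp => //; apply: measurable_funB.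
  exact: measurable_dotp_rvec.
by apply: measurable_funM => //; exact: measurable_sqr_rvec.
Qed.

(** Here and below X stands for the vector of the eps i.
    Keeping both the indicators and the exponentials makes this the common
    source of the exponential moments (B i = setT) and of the law under the
    weight exp (- s |X|^2) (b = 0). *)
Lemma gaussian_tilt_box (b : 'cV[K]_n) s (B : 'I_n -> set K) (tau := 1 + 2 * s * sigma ^+ 2) :
  0 < tau -> (forall i, measurable (B i)) ->
  (\int[P]_w (\prod_i (\1_(B i) (eps i w) *
      expR (b i 0 * eps i w - s * eps i w ^+ 2)))%:E =
  (\prod_i (expR (b i 0 ^+ 2 * sigma ^+ 2 / (2 * tau)) / Num.sqrt tau *
    fine (normal_prob (b i 0 * sigma ^+ 2 / tau) (sigma / Num.sqrt tau) (B i))))%:E)%E.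
Proof.
move=> t0 mB; apply: (@indep_integral_prod _ _ _ P n eps
  (fun i x => \1_(B i) x * expR (b i 0 * x - s * x ^+ 2))).
- exact: gauss.2.
- move=> i; apply: measurable_funM => //.
  apply: measurableT_comp => //; apply: measurable_funB => //.
  exact: measurable_funM.
- by move=> i x; rewrite mulr_ge0 ?expR_ge0.
- move=> i; rewrite (expectation_normal_tilt sigma0 (gauss.1 i))//.
  rewrite [RHS]EFinM fineK //.
  by apply: fin_num_measure; exact: mB.
Qed.

Lemma gaussian_mgf (b : 'cV[K]_n) s (tau := 1 + 2 * s * sigma ^+ 2) : 0 < tau ->
  (\int[P]_w (expR (dotp b (rvec eps w) - s * dotp (rvec eps w) (rvec eps w)))%:E =
  (expR (sigma ^+ 2 * dotp b b / (2 * tau)) / Num.sqrt tau ^+ n)%:E)%E.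
Proof.
move=> t0.
have := @gaussian_tilt_box b s (fun=> setT) t0 (fun=> measurableT).
under eq_integral do (under eq_bigr do rewrite indicT mul1r); rewrite -/tau.
under eq_integral do rewrite prod_expR_tilt.
move=> ->; congr EFin.
under eq_bigr do rewrite probability_setT mulr1.
rewrite big_split/= -expR_sum prodr_const card_ord exprVn; congr (expR _ / _).
rewrite mulr_sumr mulr_suml; apply: eq_bigr => i _.
by rewrite mulrC -[b i 0 * b i 0]expr2 [_ * sigma ^+ 2]mulrC [RHS]mulrC.
Qed.

Definition sample (w : Omega) : n.-tuple K := [tuple eps i w | i < n].

Lemma measurable_sample : measurable_fun setT sample.
Proof.
apply/measurable_fun_tnthP => i.
by rewrite (_ : _ \o _ = eps i)//; apply/funext => w /=; rewrite tnth_mktuple.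
Qed.

Definition scaled_sample (r : K) (w : Omega) : n.-tuple K := [tuple eps i w / r | i < n].

Lemma measurable_scaled_sample r : measurable_fun setT (scaled_sample r).
Proof.
apply/measurable_fun_tnthP => i.
rewrite (_ : _ \o _ = fun w => eps i w / r); first exact: measurable_funM.
by apply/funext => w /=; rewrite tnth_mktuple.
Qed.

(** Under the weight exp (- s |X|^2), X is distributed like X / sqrt tau, up to
    the total mass.  For a function f of the direction X / |X| both integrands
    involve the same value of f, and the identity, valid for all s, says that
    direction and norm are independent. *)
Lemma gaussian_scale s (f : n.-tuple K -> \bar K) (tau := 1 + 2 * s * sigma ^+ 2) :
  0 < tau -> measurable_fun setT f -> (forall t, 0 <= f t)%E ->
  (\int[P]_w ((expR (- s * dotp (rvec eps w) (rvec eps w)))%:E * f (sample w)) =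
   \int[P]_w ((Num.sqrt tau ^- n)%:E * f (scaled_sample (Num.sqrt tau) w)))%E.
Proof.
move=> t0 mf f0.
have st0 : 0 < Num.sqrt tau by rewrite sqrtr_gt0.
pose Z w : K := expR (- s * dotp (rvec eps w) (rvec eps w)).
have ZE w : Z w = expR (dotp 0 (rvec eps w) - s * dotp (rvec eps w) (rvec eps w)).
  by rewrite /Z dotp0l sub0r mulNr.
have mZ : measurable_fun setT Z.
  by rewrite (funext ZE); exact: measurable_tilt.
have Z0 w : 0 <= Z w by exact: expR_ge0.
apply: (ge0_integral_transfer (Z1 := Z) (Z2 := cst (Num.sqrt tau ^- n))) => //.
- exact: measurable_sample.
- exact: measurable_scaled_sample.
- by move=> w; rewrite /= invr_ge0 exprn_ge0// ltW.
apply: (weighted_law_unique (Z1 := Z) (Z2 := cst (Num.sqrt tau ^- n))) => //.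
- exact: measurable_sample.
- exact: measurable_scaled_sample.
- by move=> w; rewrite /= invr_ge0 exprn_ge0// ltW.
- by under eq_integral do rewrite ZE; rewrite gaussian_mgf// ltry.
move=> B mB; rewrite /weighted_law.
have mS : measurable (sample @^-1` box B).
  by rewrite -[X in measurable X]setTI; apply: measurable_sample => //; exact: measurable_box.
have mSS : measurable (scaled_sample (Num.sqrt tau) @^-1` box B).
  rewrite -[X in measurable X]setTI; apply: measurable_scaled_sample => //.
  exact: measurable_box.
rewrite [RHS]/= integral_cst// integral_mkcond.
pose B' i := (fun x : K => x / Num.sqrt tau) @^-1` B i.
have -> : scaled_sample (Num.sqrt tau) @^-1` box B =
    \bigcap_(i in [set: 'I_n]) (eps i @^-1` B' i).
  apply/seteqP; split => w /= Bw i; first by move=> _; have := Bw i; rewrite tnth_mktuple.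
  by rewrite tnth_mktuple; exact: (Bw i).
have -> : (P : {measure set Omega -> \bar K}) (\bigcap_(i in [set: 'I_n]) (eps i @^-1` B' i)) =
    (\prod_i normal_prob 0 (sigma / Num.sqrt tau) (B i))%E.
  rewrite [LHS](gauss.2 B').
    by apply: eq_bigr => i _; rewrite -(normal_scale sigma0 (gauss.1 i) st0 (mB i)).
  by move=> i; rewrite -[X in measurable X]setTI; apply: (measurable_funM (f := id)).
have := @gaussian_tilt_box 0 s B t0 mB; rewrite -/tau => H.
transitivity (\int[P]_w (\prod_i (\1_(B i) (eps i w) *
      expR ((0 : 'cV[K]_n) i 0 * eps i w - s * eps i w ^+ 2)))%:E)%E.
  apply: eq_integral => w _; rewrite epatch_indic/= -EFinM; congr EFin.
  rewrite big_split/= prod_expR_tilt -ZE mulrC; congr (_ * _).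
  rewrite indicE; have [/set_mem wB|wB] := boolP (w \in _).
    by rewrite big1// => i _; rewrite indicE mem_set//; have := wB i; rewrite tnth_mktuple.
  have [i wBi] : exists i, ~ B i (eps i w).
    apply/existsNP => wBi; move: wB; rewrite notin_setE; apply => i.
    by rewrite tnth_mktuple; exact: wBi.
  by rewrite (bigD1 i)//= indicE memNset// mul0r.
rewrite H big_split/= EFinM; congr (_ * _)%E.
  congr EFin; rewrite (eq_bigr (fun=> (Num.sqrt tau)^-1)).
    by rewrite prodr_const card_ord exprVn.
  by move=> i _; rewrite mxE expr0n/= !mul0r expR0 mul1r.
rewrite -prodEFin; apply: eq_bigr => i _.
have -> : (0 : 'cV[K]_n) i 0 = 0 by rewrite mxE.
rewrite !mul0r; apply: fineK; apply: fin_num_measure; exact: mB.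
Qed.

End GaussianVector.

(** * Hyperbolic functions, elementary inequalities, Markov's bound *)

Section RealInequalities.
Context {K : realType}.

Definition coshR (x : K) : K := (expR x + expR (- x)) / 2.
Definition sinhR (x : K) : K := (expR x - expR (- x)) / 2.

Lemma coshR_ge0 x : 0 <= coshR x.
Proof. by rewrite divr_ge0// addr_ge0 ?expR_ge0. Qed.

Lemma expR_normr_le_coshR (l x : K) : expR (l * `|x|) <= 2 * coshR (l * x).
Proof.
rewrite /coshR [leRHS]mulrC divfK//.
have [_|_] := ler0P x; rewrite ?mulrN; first by rewrite lerDr expR_ge0.
by rewrite lerDl expR_ge0.
Qed.

Lemma mul_sinhR_ge0 y : 0 <= y * sinhR y.
Proof.
rewrite /sinhR; have [y0|y0] := leP 0 y.
  by rewrite mulr_ge0// divr_ge0// subr_ge0 ler_expR; lra.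
by rewrite nmulr_rge0// pmulr_lle0// subr_le0 ler_expR; lra.
Qed.

Lemma bernoulli_ineq (q : K) k : 0 <= q -> 1 + k%:R * (q - 1) <= q ^+ k.
Proof.
move=> q0; elim: k => [|k IH]; first by rewrite mul0r addr0 expr0.
rewrite exprS -natr1; apply: le_trans (ler_wpM2l q0 IH).
have : 0 <= k%:R * (q - 1) ^+ 2 by rewrite mulr_ge0 ?sqr_ge0.
by nra.
Qed.

Let esum (N : nat) (x : K) : K := \sum_(0 <= j < N) x ^+ j / (j`!)%:R.

Let cvg_esum x : esum N x @[N --> \oo] --> expR x.
Proof. exact: is_cvg_series_exp_coeff. Qed.

Let mul_esum N (x : K) : x * esum N x = \sum_(0 <= j < N.+1) j%:R * (x ^+ j / (j`!)%:R).
Proof.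
rewrite big_nat_recl// mul0r add0r mulr_sumr; apply: eq_bigr => j _.
rewrite exprS factS natrM invfM; field.
by rewrite nat1r !pnatr_eq0 -lt0n fact_gt0.
Qed.

(** In q, cosh (y sqrt q) is a power series with nonnegative coefficients,
    hence convex, and the left-hand side is its tangent at q = 1.  Applied to
    each power of q, the tangent inequality is Bernoulli's. *)
Lemma coshR_tangent (y q : K) : 0 <= q ->
  coshR y + y * sinhR y / 2 * (q - 1) <= coshR (y * Num.sqrt q).
Proof.
move=> q0; rewrite /coshR /sinhR; set z := y * Num.sqrt q.
pose L N := (esum N.+1 y + esum N.+1 (- y)) / 2 +
  (y * esum N y + - y * esum N (- y)) / 2 / 2 * (q - 1).
pose R N := (esum N.+1 z + esum N.+1 (- z)) / 2.
have cE x : esum N.+1 x @[N --> \oo] --> expR x.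
  by rewrite (cvg_shiftS (esum ^~ x)); exact: cvg_esum.
have cL : L N @[N --> \oo] -->
    (expR y + expR (- y)) / 2 +
    (y * expR y + - y * expR (- y)) / 2 / 2 * (q - 1).
  apply: cvgD.
    by apply: cvgM; [apply: cvgD; exact: cE|exact: cvg_cst].
  apply: cvgM; last exact: cvg_cst.
  apply: cvgM; last exact: cvg_cst.
  apply: cvgM; last exact: cvg_cst.
  by apply: cvgD; apply: cvgM; try exact: cvg_cst; exact: cvg_esum.
have cR : R N @[N --> \oo] --> (expR z + expR (- z)) / 2.
  by apply: cvgM; [apply: cvgD; exact: cE|exact: cvg_cst].
have -> : y * ((expR y - expR (- y)) / 2) / 2 * (q - 1) =
  (y * expR y + - y * expR (- y)) / 2 / 2 * (q - 1) by field.
apply: ler_cvg_to cL cR _; apply: nearW => N; rewrite /L /R.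
rewrite !mul_esum /esum -!big_split/= !mulr_suml -big_split/=.
apply: ler_sum => j _; rewrite -!mulrDl.
have fj : 0 < (j`!)%:R :> K by rewrite ltr0n fact_gt0.
rewrite -mulrDr -mulrDl (exprNn y) (exprNn z) /z exprMn.
have [jo|je] := boolP (odd j).
  by rewrite -signr_odd jo expr1 !mulN1r !subrr !mul0r mulr0 !mul0r addr0.
rewrite -signr_odd (negbTE je) expr0 !mul1r.
have jE : j = (2 * j./2)%N by rewrite mul2n -[LHS]odd_double_half (negbTE je) add0n.
have -> : Num.sqrt q ^+ j = q ^+ j./2 by rewrite {1}jE exprM sqr_sqrtr.
have -> : j%:R = 2 * (j./2)%:R :> K by rewrite {1}jE natrM.
have yj : 0 <= y ^+ j by rewrite jE exprM exprn_ge0 ?sqr_ge0.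
have B := ler_wpM2l (divr_ge0 yj (ltW fj)) (bernoulli_ineq j./2 q0).
apply: (@le_trans _ _ (y ^+ j / (j`!)%:R * (1 + (j./2)%:R * (q - 1)))).
  by rewrite le_eqVlt; apply/orP; left; apply/eqP; field; rewrite gt_eqF.
apply: le_trans B _.
by rewrite le_eqVlt; apply/orP; left; apply/eqP; field; rewrite gt_eqF.
Qed.

(** Follows from (1 + z) (1 - z + z^2) = 1 + z^3. *)
Lemma expR_sub_sqr_le (z : K) : 0 <= z -> expR (z - z ^+ 2) <= 1 + z.
Proof.
move=> z0; have z1 : 0 < 1 + z by rewrite ltr_pwDl.
have := expR_ge1Dx (z ^+ 2 - z); rewrite -opprB expRN => H.
rewrite -[leRHS]invrK -lef_pV2 ?posrE ?invr_gt0 ?expR_gt0// invrK.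
apply: le_trans H; rewrite -[(1 + z)^-1]mul1r ler_pdivrMr//.
have : 0 <= z ^+ 3 by rewrite exprn_ge0.
by nra.
Qed.

Lemma sqrt_pow_le n (z : K) : 0 <= z ->
  Num.sqrt (1 + z) ^- n <= expR (- n%:R * (z - z ^+ 2) / 2).
Proof.
move=> z0.
have h : expR ((z - z ^+ 2) / 2) <= Num.sqrt (1 + z).
  rewrite -[leLHS]ger0_norm ?expR_ge0// -sqrtr_sqr ler_sqrt ?addr_ge0//.
  by rewrite -expRM_natl -[2%:R * _]mulrC divfK// expR_sub_sqr_le.
have -> : - n%:R * (z - z ^+ 2) / 2 = - (((z - z ^+ 2) / 2) *+ n).
  by rewrite -mulr_natl; ring.
rewrite expRN -mulr_natl expRM_natl lef_pV2 ?posrE ?exprn_gt0 ?expR_gt0 ?sqrtr_gt0 ?ltr_pwDl//.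
by apply: lerXn2r => //; rewrite ?nnegrE ?expR_ge0 ?sqrtr_ge0.
Qed.

End RealInequalities.

Section Markov.
Context {K : realType} {d : measure_display} {Omega : measurableType d}.
Variable P : probability Omega K.

Lemma measurable_ge (G : Omega -> K) (c : K) : measurable_fun setT G ->
  measurable [set w | c <= G w].
Proof.
move=> mG; rewrite -[X in measurable X]setTI (_ : [set w | _] = G @^-1` `[c, +oo[%classic).
  exact: mG.
by apply/seteqP; split => w /=; rewrite in_itv/= andbT.
Qed.

Lemma markov_bound (G : Omega -> K) (e c : K) :
  measurable_fun setT G -> (forall w, 0 <= G w) -> 0 < c ->
  (\int[P]_w (G w)%:E <= e%:E)%E -> (P [set w | (c <= G w)%R] <= (e / c)%:E)%E.
Proof.
move=> mG G0 c0 Ge.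
have mA := measurable_ge c mG.
rewrite mulrC EFinM lee_pdivlMl//.
apply: le_trans Ge.
rewrite -[X in (_ * P X)%E]setIT -integral_indic// -ge0_integralZl_EFin//.
- apply: ge0_le_integral => //.
  + by move=> w _; rewrite -EFinM lee_fin mulr_ge0 ?(ltW c0).
  + by apply: measurable_funeM; apply/measurable_EFinP; exact: measurable_indic.
  + exact/measurable_EFinP.
  + move=> w _; rewrite -EFinM lee_fin indicE.
    have [/set_mem/= cw|_] := boolP (w \in _); first by rewrite mulr1.
    by rewrite mulr0.
- by apply/measurable_EFinP; exact: measurable_indic.
- exact: ltW.
Qed.

End Markov.

(** * Lower tail of the norm of a Gaussian vector *)

Section GaussianTails.
Context {K : realType} {d : measure_display} {Omega : measurableType d}.
Variables (P : probability Omega K) (n : nat) (sigma : K).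
Variable eps : 'I_n -> {RV P >-> K}.
Hypothesis sigma0 : 0 < sigma.
Hypothesis gauss : isotropic_gaussian sigma eps.

Let rho2 w := dotp (rvec eps w) (rvec eps w).

Lemma expectation_exp_sqr s (tau := 1 + 2 * s * sigma ^+ 2) : 0 < tau ->
  (\int[P]_w (expR (- s * rho2 w))%:E = (Num.sqrt tau ^- n)%:E)%E.
Proof.
move=> t0; have := gaussian_mgf sigma0 gauss 0 t0.
under eq_integral do rewrite dotp0l sub0r -mulNr.
by rewrite dotp0l mulr0 mul0r expR0 div1r.
Qed.

Lemma measurable_exp_sqr s : measurable_fun setT (fun w => expR (s * rho2 w)).
Proof.
apply: measurableT_comp => //; apply: measurable_funM => //.
exact: measurable_sqr_rvec.
Qed.

(** Chernoff's bound with weight exp (- s |X|^2).  In terms of z = 2 s sigma^2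
    the exponent is at most n z^2 / 2 - z sqrt (8 a n) / 2, which is minimal,
    with value - a, at z = sqrt (8 a n) / (2 n). *)
Lemma gaussian_lower_tail a : 0 < a -> (0 < n)%N ->
  (P [set w | (rho2 w <= sigma ^+ 2 * (n%:R - Num.sqrt (8 * a * n%:R)))%R] <=
   (expR (- a))%:E)%E.
Proof.
move=> a0 n0; have nR0 : 0 < n%:R :> K by rewrite ltr0n.
set r8 := Num.sqrt _; have r80 : 0 <= r8 by exact: sqrtr_ge0.
have r8E : r8 ^+ 2 = 8 * a * n%:R.
  by rewrite sqr_sqrtr// !mulr_ge0// ltW.
pose z := r8 / (2 * n%:R); pose s := z / (2 * sigma ^+ 2).
have z0 : 0 <= z by rewrite divr_ge0// mulr_ge0// ltW.
have tauE : 1 + 2 * s * sigma ^+ 2 = 1 + z.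
  by rewrite /s; field; rewrite gt_eqF.
have t0 : 0 < 1 + 2 * s * sigma ^+ 2 by rewrite tauE ltr_pwDl.
have r8p : 0 < r8 by rewrite sqrtr_gt0 !mulr_gt0.
have s0 : 0 < s by rewrite !divr_gt0 ?mulr_gt0 ?exprn_gt0.
set t := sigma ^+ 2 * _.
have := @markov_bound _ _ _ P (fun w => expR (- s * rho2 w))
  (Num.sqrt (1 + z) ^- n) (expR (- s * t)) (measurable_exp_sqr _)
  (fun w => expR_ge0 _) (expR_gt0 _).
rewrite -{1}tauE expectation_exp_sqr// lexx => /(_ isT) H.
have -> : [set w | (rho2 w <= t)%R] = [set w | (expR (- s * t) <= expR (- s * rho2 w))%R].
  by apply/seteqP; split => w /=; rewrite ler_expR ler_nM2l// oppr_lt0.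
apply: le_trans H _; rewrite lee_fin ler_pdivrMr ?expR_gt0//.
apply: le_trans (sqrt_pow_le n z0) _; rewrite -expRD ler_expR.
rewrite le_eqVlt; apply/orP; left; apply/eqP.
have aE : a = r8 ^+ 2 / (8 * n%:R) by rewrite r8E; field; rewrite gt_eqF.
rewrite {1}aE /s /z /t -/r8; field.
by rewrite !gt_eqF.
Qed.

End GaussianTails.

(** * Directions of a Gaussian vector *)

Section Direction.
Context {K : realType} {n : nat}.
Implicit Types (v : 'cV[K]_n) (t : n.-tuple K).

(** The scaling by sqrt n makes this, for a unit vector v and a Gaussian t,
    comparable with a standard normal variable.  At t = 0 division by zero
    gives the value 0. *)
Definition direction v t : K :=
  Num.sqrt n%:R * (\sum_i v i 0 * tnth t i) / Num.sqrt (\sum_i tnth t i ^+ 2).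

Lemma measurable_direction v : measurable_fun setT (direction v).
Proof.
apply: measurable_funM.
  apply: measurable_funM => //; apply: measurable_sum => i.
  by apply: measurable_funM => //; exact: measurable_tnth.
have sE t : (Num.sqrt (\sum_i tnth t i ^+ 2))^-1 = (\sum_i tnth t i ^+ 2) `^ (- 2^-1).
  by rewrite powRN powR12_sqrt// sumr_ge0// => i _; rewrite sqr_ge0.
rewrite (funext sE); apply: (measurableT_comp (measurable_powR _)).
by apply: measurable_sum => i; apply: measurable_funX; exact: measurable_tnth.
Qed.

End Direction.

Section SphereMgf.
Context {K : realType} {d : measure_display} {Omega : measurableType d}.
Variables (P : probability Omega K) (n : nat) (sigma : K).
Variable eps : 'I_n -> {RV P >-> K}.
Hypothesis sigma0 : 0 < sigma.
Hypothesis gauss : isotropic_gaussian sigma eps.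
Hypothesis n0 : (0 < n)%N.

Let rho2 w := dotp (rvec eps w) (rvec eps w).

Lemma direction_sample v w : direction v (sample eps w) =
  Num.sqrt n%:R * dotp v (rvec eps w) / Num.sqrt (rho2 w).
Proof.
rewrite /direction dotp_rvec /rho2 sqr_rvec.
congr (_ * _ / Num.sqrt _); apply: eq_bigr => i _; by rewrite tnth_mktuple.
Qed.

Lemma direction_scaled_sample v r w : 0 < r ->
  direction v (scaled_sample eps r w) = direction v (sample eps w).
Proof.
move=> r0; rewrite /direction.
have -> : \sum_i v i 0 * tnth (scaled_sample eps r w) i =
    (\sum_i v i 0 * tnth (sample eps w) i) / r.
  by rewrite mulr_suml; apply: eq_bigr => i _; rewrite !tnth_mktuple mulrA.
have -> : \sum_i tnth (scaled_sample eps r w) i ^+ 2 =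
    (\sum_i tnth (sample eps w) i ^+ 2) / r ^+ 2.
  by rewrite mulr_suml; apply: eq_bigr => i _; rewrite !tnth_mktuple expr_div_n.
rewrite sqrtrM ?sumr_ge0//; last by move=> i _; rewrite sqr_ge0.
rewrite sqrtrV ?sqr_ge0// sqrtr_sqr gtr0_norm// invfM invrK.
by rewrite mulrA -!mulrA [X in _ * (_ * X)]mulrCA mulVf ?mulr1// gt_eqF.
Qed.

Lemma normr_direction_le v w : dotp v v <= 1 ->
  `|direction v (sample eps w)| <= Num.sqrt n%:R.
Proof.
move=> v1; rewrite direction_sample !normrM ger0_norm ?sqrtr_ge0// -mulrA.
rewrite -[leRHS]mulr1 ler_wpM2l ?sqrtr_ge0// normfV (ger0_norm (sqrtr_ge0 _)).
have [r0|r0] := eqVneq (Num.sqrt (rho2 w)) 0; first by rewrite r0 invr0 mulr0.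
have rp : 0 < Num.sqrt (rho2 w) by rewrite lt_neqAle eq_sym r0 sqrtr_ge0.
rewrite ler_pdivrMr// mul1r -sqrtr_sqr ler_sqrt ?dotp_ge0//.
by apply: le_trans (cauchy_schwarz _ _) _; rewrite ler_piMl// dotp_ge0.
Qed.

Lemma direction_radius v w :
  direction v (sample eps w) * Num.sqrt (rho2 w / (n%:R * sigma ^+ 2)) =
  dotp v (rvec eps w) / sigma.
Proof.
have nR0 : 0 < n%:R :> K by rewrite ltr0n.
have sn : Num.sqrt n%:R != 0 :> K by rewrite gt_eqF// sqrtr_gt0.
rewrite direction_sample sqrtrM ?dotp_ge0//.
have -> : Num.sqrt (n%:R * sigma ^+ 2)^-1 = (Num.sqrt n%:R * sigma)^-1.
  have ns : 0 <= n%:R * sigma ^+ 2 by rewrite mulr_ge0// sqr_ge0.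
  by rewrite sqrtrV// sqrtrM// sqrtr_sqr gtr0_norm.
have [r0|r0] := eqVneq (Num.sqrt (rho2 w)) 0.
  rewrite r0 invr0 mulr0 !mul0r.
  move/eqP: r0; rewrite sqrtr_eq0 => r0.
  have X0 : rvec eps w = 0 by apply/eqP; rewrite -dotp_eq0 eq_le r0 dotp_ge0.
  by rewrite X0 /dotp big1 ?mul0r// => i _; rewrite mxE mulr0.
by field; rewrite sn r0 gt_eqF.
Qed.

Lemma expectation_cosh_linear v lam : dotp v v <= 1 ->
  (\int[P]_w (coshR (lam * (dotp v (rvec eps w) / sigma)))%:E <=
   (expR (lam ^+ 2 / 2))%:E)%E.
Proof.
move=> v1.
have mgf (l : K) : (\int[P]_w (expR (l * (dotp v (rvec eps w) / sigma)))%:E =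
    (expR (l ^+ 2 * dotp v v / 2))%:E)%E.
  have t0 : 0 < 1 + 2 * 0 * sigma ^+ 2 by rewrite mulr0 mul0r addr0.
  have := gaussian_mgf sigma0 gauss ((l / sigma) *: v) t0.
  rewrite mulr0 mul0r addr0 sqrtr1 expr1n divr1 mulr1 dotpZl dotpZr => H.
  under eq_integral => w _.
    have -> : l * (dotp v (rvec eps w) / sigma) =
      dotp ((l / sigma) *: v) (rvec eps w) - 0 * rho2 w.
      by rewrite mul0r subr0 dotpZl mulrA mulrAC.
    over.
  rewrite H; congr (expR _)%:E; field.
  by rewrite gt_eqF.
have mexp l : measurable_fun setT
    (fun w => expR (l * (dotp v (rvec eps w) / sigma))).
  apply: measurableT_comp => //; apply: measurable_funM => //.
  by apply: measurable_funM => //; exact: measurable_dotp_rvec.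
have coshE w : (coshR (lam * (dotp v (rvec eps w) / sigma)))%:E =
  (2^-1%:E * ((expR (lam * (dotp v (rvec eps w) / sigma)))%:E +
    (expR (- lam * (dotp v (rvec eps w) / sigma)))%:E))%E.
  by rewrite -EFinD -EFinM /coshR mulrC mulNr.
under eq_integral do rewrite coshE.
rewrite ge0_integralZl_EFin//; first last.
- by apply: emeasurable_funD; apply/measurable_EFinP; exact: mexp.
- by move=> w _; rewrite -EFinD lee_fin addr_ge0 ?expR_ge0.
rewrite ge0_integralD//.
- rewrite !mgf sqrrN -EFinD -EFinM lee_fin.
  have -> : forall x : K, 2^-1 * (x + x) = x by move=> x; field.
  rewrite ler_expR ler_pM2r// ler_piMr// sqr_ge0//.
- by apply/measurable_EFinP; exact: mexp.
- by apply/measurable_EFinP; exact: mexp.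
Qed.

(** With q = |X|^2 / (n sigma^2), the variable cosh (lam <v, X> / sigma) equals
    cosh (u sqrt q), where u is lam times the direction of X along v, and is at
    least cosh u + D (q - 1), the tangent at q = 1, where D >= 0 depends on the
    direction only.  It remains to see that the mean of D (q - 1) is nonnegative.
    The scaling identity gives access to means of D exp (- s q) only, so q - 1
    is bounded below by (1 - exp (- s (q - 1))) / s, whose product with D has a
    mean at least - O(s), and s tends to 0. *)
Lemma sphere_mgf v lam : dotp v v <= 1 ->
  (\int[P]_w (coshR (lam * direction v (sample eps w)))%:E <=
   (expR (lam ^+ 2 / 2))%:E)%E.
Proof.
move=> v1; have nR0 : 0 < n%:R :> K by rewrite ltr0n.
have nR1 : 1 <= n%:R :> K by rewrite ler1n.
pose u t := lam * direction v t.
pose D t := u t * sinhR (u t) / 2.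
have mu : measurable_fun setT u.
  by apply: measurable_funM => //; exact: measurable_direction.
have mexpu : measurable_fun setT (fun t => expR (u t)) by exact: measurableT_comp.
have mexpNu : measurable_fun setT (fun t => expR (- u t)).
  by apply: measurableT_comp => //; apply: measurable_funN.
have mcosh : measurable_fun setT (fun t => coshR (u t)).
  by apply: measurable_funM => //; apply: measurable_funD.
have mD : measurable_fun setT D.
  apply: measurable_funM => //; apply: measurable_funM => //.
  by apply: measurable_funM => //; apply: measurable_funB.
have D0 t : 0 <= D t by rewrite divr_ge0// mul_sinhR_ge0.
have ms := measurable_sample eps.
have mcoshs : measurable_fun setT (fun w => (coshR (u (sample eps w)))%:E).
  by apply/measurable_EFinP; exact: (measurableT_comp mcosh).
have mDs : measurable_fun setT (fun w => (D (sample eps w))%:E).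
  by apply/measurable_EFinP; exact: (measurableT_comp mD).
pose M := `|lam| * Num.sqrt n%:R.
have uM w : `|u (sample eps w)| <= M.
  by rewrite normrM ler_wpM2l// normr_direction_le.
have expM w : expR (u (sample eps w)) <= expR M /\ expR (- u (sample eps w)) <= expR M.
  by rewrite !ler_expR; move: (uM w); rewrite ler_norml => /andP[]; lra.
have fin (f : K -> K) (c : K) : measurable_fun setT (fun w => (f (u (sample eps w)))%:E) ->
    (forall w, 0 <= f (u (sample eps w)) <= c) ->
    exists2 e : K, 0 <= e & (\int[P]_w (f (u (sample eps w)))%:E = e%:E)%E.
  move=> mf fc.
  have I0 : (0 <= \int[P]_w (f (u (sample eps w)))%:E)%E.
    by apply: integral_ge0 => w _; rewrite lee_fin; case/andP: (fc w).
  have Ic : (\int[P]_w (f (u (sample eps w)))%:E <= c%:E)%E.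
    rewrite -[leRHS]mule1 -(probability_setT P) -integral_cst//.
    apply: ge0_le_integral => //.
    - by move=> w _; rewrite lee_fin; case/andP: (fc w).
    - by move=> w _; rewrite lee_fin; case/andP: (fc w).
  exists (fine (\int[P]_w (f (u (sample eps w)))%:E)); first exact: fine_ge0.
  by rewrite fineK// ge0_fin_numE// (le_lt_trans Ic) ?ltry.
have [c1 c10 c1E] : exists2 e : K, 0 <= e &
    (\int[P]_w (coshR (u (sample eps w)))%:E = e%:E)%E.
  apply: (fin coshR (expR M)) => // w; rewrite coshR_ge0 /coshR.
  by case: (expM w); lra.
have [dD dD0 dDE] : exists2 e : K, 0 <= e &
    (\int[P]_w (D (sample eps w))%:E = e%:E)%E.
  apply: (fin (fun y => y * sinhR y / 2) (M * expR M)) => // w; rewrite D0/=.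
  have M0 : 0 <= M by rewrite mulr_ge0 ?sqrtr_ge0.
  have : `|u (sample eps w) * sinhR (u (sample eps w))| <= M * expR M.
    rewrite normrM; apply: ler_pM => //.
    rewrite /sinhR ler_norml.
    have e0 := expR_ge0 (u (sample eps w)); have e1 := expR_ge0 (- u (sample eps w)).
    by case: (expM w) => *; apply/andP; split; lra.
  have : 0 <= u (sample eps w) * sinhR (u (sample eps w)) by exact: mul_sinhR_ge0.
  by move=> p0; rewrite ger0_norm//; lra.
rewrite -/(u _) c1E lee_fin.
suff step s : 0 < s <= 1 -> c1 <= expR (lam ^+ 2 / 2) + dD * (2 * s * expR 2).
  apply/ler_addgt0Pr => e e0.
  have e2 : 0 < expR 2 :> K by exact: expR_gt0.
  pose c := 1 + dD * (2 * expR 2).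
  have cp : 0 < c by rewrite ltr_pwDl// mulr_ge0// mulr_ge0// ltW.
  pose s := Num.min 1 (e / c).
  have s01 : 0 < s <= 1 by rewrite lt_min ltr01 divr_gt0//= ge_min lexx.
  apply: le_trans (step s s01) _; rewrite lerD2l.
  have sc : s * c <= e by rewrite -ler_pdivlMr// ge_min lexx orbT.
  apply: le_trans sc; rewrite /c; case/andP: s01 => s0 _; nra.
move=> /andP[s0 s1].
pose s' := s / (n%:R * sigma ^+ 2).
have tauE : 1 + 2 * s' * sigma ^+ 2 = 1 + 2 * s / n%:R.
  by rewrite /s'; field; rewrite !gt_eqF.
have t0 : 0 < 1 + 2 * s' * sigma ^+ 2.
  by rewrite tauE ltr_pwDl// divr_ge0// mulr_ge0// ltW.
have pointwise w : coshR (u (sample eps w)) + s^-1 * D (sample eps w) <=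
    coshR (lam * (dotp v (rvec eps w) / sigma)) +
    expR s / s * (expR (- s' * rho2 w) * D (sample eps w)).
  set q := rho2 w / (n%:R * sigma ^+ 2).
  have q0 : 0 <= q.
    by apply: divr_ge0; [exact: dotp_ge0|rewrite mulr_ge0 ?sqr_ge0].
  have := coshR_tangent (u (sample eps w)) q0.
  rewrite -/(D (sample eps w)) /u -mulrA direction_radius -/(u _) => H.
  have e1 : - s' * rho2 w = - (s * q) by rewrite /s' /q; field; rewrite !gt_eqF.
  have H2 := expR_ge1Dx (s - s * q).
  rewrite e1; move: (D0 (sample eps w)) H; move: (D _) => dd dd0.
  move: (coshR _) (coshR _) => C1 C2 H.
  have -> : expR s / s * (expR (- (s * q)) * dd) = s^-1 * expR (s - s * q) * dd.
    by rewrite expRD; ring.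
  have H3 : s^-1 * (1 + (s - s * q)) <= s^-1 * expR (s - s * q).
    by rewrite ler_wpM2l// invr_ge0 ltW.
  have H4 := ler_wpM2r dd0 H3.
  have e2 : s^-1 * (1 + (s - s * q)) = s^-1 + 1 - q by field; rewrite gt_eqF.
  rewrite e2 in H4; nra.
pose r := Num.sqrt (1 + 2 * s' * sigma ^+ 2).
have r0 : 0 < r by rewrite sqrtr_gt0.
have tiltE : (\int[P]_w (expR (- s' * rho2 w) * D (sample eps w))%:E =
    (r ^- n * dD)%:E)%E.
  have scaledD w : (EFin \o D) (scaled_sample eps r w) = (D (sample eps w))%:E.
    by rewrite /= /D /u (direction_scaled_sample v w r0).
  transitivity (\int[P]_w ((expR (- s' * rho2 w))%:E * (EFin \o D) (sample eps w))%E)%E.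
    by apply: eq_integral => w _; rewrite EFinM.
  rewrite (gaussian_scale sigma0 gauss t0); last 2 first.
  - exact/measurable_EFinP.
  - by move=> t; rewrite lee_fin; exact: D0.
  transitivity (\int[P]_w ((r ^- n)%:E * (D (sample eps w))%:E))%E.
    by apply: eq_integral => w _; rewrite scaledD.
  rewrite ge0_integralZl_EFin.
  - by rewrite dDE EFinM.
  - by [].
  - by move=> w _; rewrite lee_fin; exact: D0.
  - exact: mDs.
  - by rewrite invr_ge0 exprn_ge0// ltW.
have mtilt : measurable_fun setT
    (fun w => (expR (- s' * rho2 w) * D (sample eps w))%:E).
  apply/measurable_EFinP; apply: measurable_funM.
    exact: measurable_exp_sqr.
  exact: (measurableT_comp mD).
have mlin : measurable_fun setT
    (fun w => (coshR (lam * (dotp v (rvec eps w) / sigma)))%:E).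
  have ml : measurable_fun setT (fun w => lam * (dotp v (rvec eps w) / sigma)).
    apply: measurable_funM => //; apply: measurable_funM => //.
    exact: measurable_dotp_rvec.
  apply/measurable_EFinP; apply: measurable_funM => //; apply: measurable_funD.
    exact: measurableT_comp.
  by apply: measurableT_comp => //; exact: measurable_funN.
have int_le : (\int[P]_w (((coshR (u (sample eps w)))%:E + s^-1%:E * (D (sample eps w))%:E)) <=
   \int[P]_w ((coshR (lam * (dotp v (rvec eps w) / sigma)))%:E +
     (expR s / s)%:E * (expR (- s' * rho2 w) * D (sample eps w))%:E))%E.
  apply: ge0_le_integral => //.
  - move=> w _; rewrite -EFinM -EFinD lee_fin addr_ge0 ?coshR_ge0//.
    by rewrite mulr_ge0 ?D0// invr_ge0 ltW.
  - by apply: emeasurable_funD => //; apply: measurable_funeM.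
  - by apply: emeasurable_funD => //; apply: measurable_funeM.
  - by move=> w _; rewrite -!EFinM -!EFinD lee_fin pointwise.
move: int_le.
have sV0 : 0 <= s^-1 by rewrite invr_ge0 ltW.
have es0 : 0 <= expR s / s by rewrite mulr_ge0 ?expR_ge0.
have es0e : (0 <= (expR s / s)%:E :> \bar K)%E by rewrite lee_fin.
have sDe0 w : (0 <= s^-1%:E * (D (sample eps w))%:E)%E.
  by rewrite -EFinM lee_fin mulr_ge0 ?D0.
have tilt0 w : (0 <= (expR (- s' * rho2 w) * D (sample eps w))%:E)%E.
  by rewrite lee_fin mulr_ge0 ?D0 ?expR_ge0.
have cosh0 x : (0 <= (coshR x)%:E :> \bar K)%E by rewrite lee_fin coshR_ge0.
have msD := measurable_funeM (s^-1%:E) mDs.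
have mst := measurable_funeM ((expR s / s)%:E) mtilt.
rewrite (ge0_integralD _ measurableT (fun w _ => cosh0 _) mcoshs (fun w _ => sDe0 w) msD).
rewrite (ge0_integralD _ measurableT (fun w _ => cosh0 _) mlin
  (fun w _ => mule_ge0 es0e (tilt0 w)) mst).
have De0 w : (0 <= (D (sample eps w))%:E)%E by rewrite lee_fin; exact: D0.
rewrite (ge0_integralZl_EFin _ measurableT (fun w _ => De0 w) mDs sV0).
rewrite (ge0_integralZl_EFin _ measurableT (fun w _ => tilt0 w) mtilt es0).
rewrite c1E dDE tiltE -!EFinM -EFinD => int_le.
have {int_le} : c1 + s^-1 * dD <= expR (lam ^+ 2 / 2) + expR s / s * (r ^- n * dD).
  rewrite -lee_fin; apply: le_trans int_le _.
  by rewrite EFinD leeD2r// expectation_cosh_linear.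
(* The mass of the tilted law differs from exp (- s) by a factor that is
   1 + O(s^2). *)
have rn : expR s * r ^- n <= expR (2 * s ^+ 2).
  have z0 : 0 <= 2 * s / n%:R by rewrite divr_ge0// mulr_ge0// ltW.
  apply: (@le_trans _ _ (expR s * expR (- n%:R * (2 * s / n%:R - (2 * s / n%:R) ^+ 2) / 2))).
    by rewrite ler_wpM2l ?expR_ge0// /r tauE sqrt_pow_le.
  rewrite -expRD ler_expR.
  have -> : s + - n%:R * (2 * s / n%:R - (2 * s / n%:R) ^+ 2) / 2 = 2 * s ^+ 2 / n%:R.
    by field; rewrite gt_eqF.
  by rewrite ler_pdivrMr// ler_peMr// mulr_ge0// sqr_ge0.
have ex : expR (2 * s ^+ 2) - 1 <= 2 * s ^+ 2 * expR 2.
  have h1 := expR_ge1Dx (- (2 * s ^+ 2)).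
  have h2 : expR (2 * s ^+ 2) <= expR 2 :> K.
    by rewrite ler_expR ler_piMr// expr_le1// ltW.
  have h3 : expR (2 * s ^+ 2) * expR (- (2 * s ^+ 2)) = 1 by rewrite -expRD subrr expR0.
  have h4 : 0 <= 2 * s ^+ 2 by rewrite mulr_ge0// sqr_ge0.
  have h5 := expR_ge0 (2 * s ^+ 2).
  nra.
have -> : expR s / s * (r ^- n * dD) = s^-1 * (dD * (expR s * r ^- n)) by ring.
move=> H.
have H2 : s^-1 * (dD * (expR s * r ^- n)) <= s^-1 * (dD * (1 + 2 * s ^+ 2 * expR 2)).
  by rewrite ler_wpM2l ?invr_ge0 ?(ltW s0)// ler_wpM2l//; lra.
have E2 : s^-1 * (dD * (1 + 2 * s ^+ 2 * expR 2)) = s^-1 * dD + dD * (2 * s * expR 2).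
  by field; rewrite gt_eqF.
lra.
Qed.

End SphereMgf.

(** * Exponential moments of projections *)

Section Projection.
Context {K : realType} {n : nat}.
Implicit Types Q : 'M[K]_n.

Definition orth_proj Q := Q^T = Q /\ Q *m Q = Q.

(** Any nonzero column of Q lies in its range; removing the corresponding line
    leaves an orthogonal projection of smaller rank. *)
Lemma orth_proj_split Q : orth_proj Q -> Q != 0 ->
  exists q : 'cV[K]_n, [/\ Q *m q = q, dotp q q = 1, orth_proj (Q - q *m q^T),
    (Q - q *m q^T) *m q = 0 & (\rank (Q - q *m q^T)%R < \rank Q)%N].
Proof.
move=> [QT QQ] Q0.
have [i xi0] : exists i, col i Q != 0.
  apply/existsP; apply: contra_neqT Q0; rewrite negb_exists => /forallP H.
  by apply/matrixP => a b; have := H b; rewrite negbK => /eqP/colP/(_ a); rewrite !mxE.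
pose x := col i Q; pose l := dotp x x.
have l0 : 0 < l by rewrite lt_neqAle eq_sym dotp_eq0 xi0 dotp_ge0.
pose q := (Num.sqrt l)^-1 *: x.
have Qx : Q *m x = x by rewrite /x colE mulmxA QQ.
have Qq : Q *m q = q by rewrite /q -scalemxAr Qx.
have q1 : dotp q q = 1.
  rewrite dotpZl dotpZr mulrA -/l -expr2 exprVn sqr_sqrtr ?(ltW l0)// mulVf//.
  by rewrite gt_eqF.
have qTq : q^T *m q = 1%:M.
  by apply/matrixP => a b; rewrite !ord1 -dotpE q1 mxE.
have qTQ : q^T *m Q = q^T by rewrite -{1}QT -trmx_mul Qq.
have Pq : (Q - q *m q^T) *m q = 0.
  by rewrite mulmxBl Qq -mulmxA qTq mulmx1 subrr.
have PT : (Q - q *m q^T)^T = Q - q *m q^T.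
  by rewrite linearB/= trmx_mul trmxK QT.
exists q; split => //.
- split=> //; rewrite mulmxBr mulmxA Pq mul0mx subr0 mulmxBl QQ -mulmxA qTQ.
  by [].
- apply: rank_ltmx; rewrite /ltmx; apply/andP; split.
    have -> : Q - q *m q^T = (1%:M - q *m q^T) *m Q.
      by rewrite mulmxBl mul1mx -mulmxA qTQ.
    exact: submxMl.
  apply/negP => QP; have qP : (q^T <= (Q - q *m q^T)%R)%MS.
    by apply: submx_trans QP; rewrite -qTQ submxMl.
  case/submxP: qP => z zE.
  have : q^T *m q = 0 by rewrite zE -mulmxA Pq mulmx0.
  rewrite qTq => /matrixP/(_ 0 0); rewrite !mxE => /eqP.
  by rewrite oner_eq0.
Qed.

Lemma dotp_proj_split Q (q f : 'cV[K]_n) : orth_proj Q -> Q *m q = q -> dotp q q = 1 ->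
  dotp (Q *m f) (Q *m f) =
  dotp ((Q - q *m q^T) *m f) ((Q - q *m q^T) *m f) + dotp q f ^+ 2.
Proof.
move=> [QT QQ] Qq q1.
have qf : q *m q^T *m f = dotp q f *: q.
  rewrite -mulmxA; apply/colP => i; rewrite !mxE big_ord1 -dotpE mulrC//.
have qQf : dotp q (Q *m f) = dotp q f.
  by rewrite !dotpE mulmxA -{1}QT -trmx_mul Qq.
rewrite mulmxBl qf -scaleNr !(dotpDl, dotpDr, dotpZl, dotpZr) q1 (dotpC _ q) qQf.
by ring.
Qed.

End Projection.

Section UpperTail.
Context {K : realType} {d : measure_display} {Omega : measurableType d}.
Variables (P : probability Omega K) (n : nat) (sigma : K).
Variable eps : 'I_n -> {RV P >-> K}.
Hypothesis sigma0 : 0 < sigma.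
Hypothesis gauss : isotropic_gaussian sigma eps.

Lemma measurable_proj_sqr (Q : 'M[K]_n) :
  measurable_fun setT (fun w => dotp (Q *m rvec eps w) (Q *m rvec eps w)).
Proof.
apply: measurable_sum => i.
have mQ : measurable_fun setT (fun w => (Q *m rvec eps w) i 0).
  under eq_fun do rewrite mxE.
  apply: measurable_sum => j; apply: measurable_funM => //.
  rewrite (_ : (fun w => rvec eps w j 0) = eps j)//.
  by apply/funext => w; rewrite mxE.
exact: measurable_funM.
Qed.

Lemma std_normal_mgf (b s : K) : 0 < 1 + 2 * s ->
  (\int[normal_prob 0 1]_h (expR (b * h - s * h ^+ 2))%:E =
   (expR (b ^+ 2 / (2 * (1 + 2 * s))) / Num.sqrt (1 + 2 * s))%:E)%E.
Proof.
move=> t0.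
pose idf : measurableTypeR K -> K := fun x => x.
have midf : measurable_fun setT idf by exact: measurable_id.
pose id_mixin := isMeasurableFun.Build _ _ _ _ _ midf.
pose idm : {mfun measurableTypeR K >-> K} := HB.pack idf id_mixin.
pose X : {RV (normal_prob 0 1 : probability (measurableTypeR K) K) >-> K} := idm.
have XE (B : set K) : measurable B ->
    distribution (normal_prob 0 1 : probability (measurableTypeR K) K) X B = normal_prob 0 1 B.
  by move=> _; rewrite /distribution /pushforward preimage_id.
have t0' : 0 < 1 + 2 * s * 1 ^+ 2 by rewrite expr1n mulr1.
have := @expectation_normal_tilt K _ _ _ 1 X ltr01 XE b s setT measurableT t0'.
rewrite probability_setT mule1 expr1n !mulr1 => <-.
by apply: eq_integral => h _; rewrite indicT mul1r.
Qed.

(** By induction on the rank: for a unit vector q in the range of Q,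
    exp (k <q, X>^2) is the mean of exp (sqrt (2 k) h <q, X>) over a standard
    normal h.  Exchanging the two integrations turns one square into a linear
    term, which joins b and stays orthogonal to the range of the smaller
    projection; this is why the statement has a linear term at all. *)
Lemma gaussian_proj_mgf (Q : 'M[K]_n) (b : 'cV[K]_n) (k : K) (N : nat)
    (beta := (Num.sqrt (1 - 2 * k * sigma ^+ 2))^-1) :
  orth_proj Q -> (\rank Q <= N)%N -> Q *m b = 0 -> 0 <= k ->
  0 < 1 - 2 * k * sigma ^+ 2 ->
  (\int[P]_w (expR (k * dotp (Q *m rvec eps w) (Q *m rvec eps w) +
     dotp b (rvec eps w)))%:E <=
   (beta ^+ N * expR (sigma ^+ 2 * dotp b b / 2))%:E)%E.
Proof.
move=> pQ rN Qb k0 t0.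
have st0 : 0 < Num.sqrt (1 - 2 * k * sigma ^+ 2) by rewrite sqrtr_gt0.
have beta0 : 0 <= beta by rewrite invr_ge0 ltW.
have beta1 : 1 <= beta.
  rewrite invf_ge1// -[leRHS]sqrtr1 ler_sqrt// gerBl mulr_ge0 ?sqr_ge0// mulr_ge0//.
have lin (b' : 'cV[K]_n) : (\int[P]_w (expR (dotp b' (rvec eps w)))%:E =
    (expR (sigma ^+ 2 * dotp b' b' / 2))%:E)%E.
  have u0 : 0 < 1 + 2 * 0 * sigma ^+ 2 by rewrite mulr0 mul0r addr0.
  have := gaussian_mgf sigma0 gauss b' u0.
  rewrite mulr0 mul0r addr0 sqrtr1 expr1n divr1 mulr1 => <-.
  by apply: eq_integral => w _; rewrite mul0r subr0.
have base b' M : (\int[P]_w (expR (k *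
       dotp ((0 : 'M[K]_n) *m rvec eps w) ((0 : 'M[K]_n) *m rvec eps w) +
     dotp b' (rvec eps w)))%:E <=
   (beta ^+ M * expR (sigma ^+ 2 * dotp b' b' / 2))%:E)%E.
  have dz w : dotp ((0 : 'M[K]_n) *m rvec eps w) ((0 : 'M[K]_n) *m rvec eps w) = 0.
    by apply/eqP; rewrite dotp_eq0 mul0mx.
  under eq_integral do rewrite dz mulr0 add0r.
  by rewrite lin lee_fin ler_peMl ?expR_ge0// exprn_ege1.
elim: N Q b pQ rN Qb => [|N IH] Q b pQ rN Qb.
  have -> : Q = 0 by apply/eqP; rewrite -mxrank_eq0 -leqn0.
  exact: base.
have [->|Q0] := eqVneq Q 0; first exact: base.
have [q [Qq q1 pP Pq0 rP]] := orth_proj_split pQ Q0.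
set Q' := (Q - q *m q^T)%R in pP Pq0 rP.
have rP' : (\rank Q' <= N)%N by rewrite -ltnS (leq_trans rP).
pose c := Num.sqrt (2 * k).
have c2 : c ^+ 2 = 2 * k by rewrite sqr_sqrtr// mulr_ge0.
have qb : dotp q b = 0.
  by rewrite dotpE -Qq trmx_mul pQ.1 -mulmxA Qb mulmx0 mxE.
have Q'b h : Q' *m (b + (c * h) *: q) = 0.
  rewrite mulmxDr -scalemxAr Pq0 scaler0 addr0 mulmxBl Qb.
  by rewrite sub0r -mulmxA (_ : q^T *m b = 0) ?mulmx0 ?oppr0//;
    apply/matrixP => i j; rewrite !ord1 -dotpE qb mxE.
pose f (x : Omega * measurableTypeR K) : \bar K :=
  (expR (k * dotp (Q' *m rvec eps x.1) (Q' *m rvec eps x.1) +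
     dotp (b + (c * x.2) *: q) (rvec eps x.1)))%:E.
have mf : measurable_fun setT f.
  apply/measurable_EFinP; apply: measurableT_comp => //; apply: measurable_funD.
    apply: measurable_funM => //.
    by apply: (measurableT_comp (measurable_proj_sqr Q')).
  have dE x : dotp (b + (c * x.2) *: q) (rvec eps x.1) =
      dotp b (rvec eps x.1) + c * x.2 * dotp q (rvec eps x.1) :> K.
    by rewrite dotpDl dotpZl.
  under eq_fun do rewrite dE.
  apply: measurable_funD.
    by apply: (measurableT_comp (measurable_dotp_rvec eps b)).
  apply: measurable_funM; first exact: measurable_funM.
  by apply: (measurableT_comp (measurable_dotp_rvec eps q)).
have f0 x : (0 <= f x)%E by rewrite lee_fin expR_ge0.
have inner w : (\int[normal_prob 0 1]_h f (w, h) =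
    (expR (k * dotp (Q *m rvec eps w) (Q *m rvec eps w) + dotp b (rvec eps w)))%:E)%E.
  pose A := expR (k * dotp (Q' *m rvec eps w) (Q' *m rvec eps w) + dotp b (rvec eps w)).
  have fE h : f (w, h) = (A%:E * (expR (c * dotp q (rvec eps w) * h - 0 * h ^+ 2))%:E)%E.
    rewrite /f /A /= -EFinM -expRD dotpDl dotpZl; congr (expR _)%:E; ring.
  under eq_integral do rewrite fE.
  have u0 : 0 < 1 + 2 * 0 :> K by rewrite mulr0 addr0.
  rewrite ge0_integralZl_EFin//; last 2 first.
  - by apply/measurable_EFinP; exact: measurable_exp_quad.
  - exact: expR_ge0.
  rewrite std_normal_mgf// -EFinM mulr0 addr0 sqrtr1 divr1 mulr1 -expRD.
  congr (expR _)%:E; rewrite (dotp_proj_split _ pQ Qq q1) exprMn c2.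
  by field.
under eq_integral do rewrite -inner.
rewrite (fubini_tonelli f)//.
apply: (@le_trans _ _ (\int[normal_prob 0 1]_h
   ((beta ^+ N * expR (sigma ^+ 2 * dotp b b / 2))%:E *
    (expR (0 * h - (- (k * sigma ^+ 2)) * h ^+ 2))%:E))%E).
  apply: ge0_le_integral => //.
  - by move=> h _; apply: integral_ge0.
  - exact: (measurable_fun_fubini_tonelli_G f).
  - by apply: measurable_funeM; apply/measurable_EFinP; exact: measurable_exp_quad.
  - move=> h _; apply: le_trans (IH Q' _ pP rP' (Q'b h)) _.
    rewrite -EFinM lee_fin -[leRHS]mulrA -expRD ler_wpM2l ?exprn_ge0//.
    rewrite ler_expR dotpDl !dotpDr !dotpZl !dotpZr q1 (dotpC b) qb.
    rewrite le_eqVlt; apply/orP; left; apply/eqP.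
    have -> : k = c ^+ 2 / 2 by rewrite c2; field.
    by field.
rewrite ge0_integralZl_EFin//; last 2 first.
- by apply/measurable_EFinP; exact: measurable_exp_quad.
- by rewrite mulr_ge0 ?expR_ge0 ?exprn_ge0.
have t1 : 1 + 2 * - (k * sigma ^+ 2) = 1 - 2 * k * sigma ^+ 2 by ring.
rewrite std_normal_mgf t1// expr0n/= mul0r expR0 -EFinM lee_fin.
by rewrite div1r -/beta (exprS beta N) [leLHS]mulrC mulrA.
Qed.

End UpperTail.

(** * Upper tail and self-normalised maximum *)

Section Events.
Context {K : realType} {d : measure_display} {Omega : measurableType d}.
Variables (P : probability Omega K) (n : nat) (sigma : K).
Variable eps : 'I_n -> {RV P >-> K}.
Hypothesis sigma0 : 0 < sigma.
Hypothesis gauss : isotropic_gaussian sigma eps.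

(** Chernoff's bound.  With p = sqrt r and q = sqrt (2 a), the rate k is the one
    for which 1 - 2 k sigma^2 = p / (p + q).  Then the exponential moment is
    (1 + q / p)^(p^2 / 2) <= exp (p q / 2), and dividing by
    exp (k sigma^2 (p + q)^2) = exp (q (p + q) / 2) leaves exp (- q^2 / 2). *)
Lemma gaussian_upper_tail (Q : 'M[K]_n) (a : K) (r : nat) :
  orth_proj Q -> (\rank Q <= r)%N -> 0 < a ->
  (P [set w | (sigma ^+ 2 * (Num.sqrt r%:R + Num.sqrt (2 * a)) ^+ 2 <=
     dotp (Q *m rvec eps w) (Q *m rvec eps w))%R] <= (expR (- a))%:E)%E.
Proof.
move=> pQ rQ a0; set q := Num.sqrt (2 * a); set p := Num.sqrt r%:R.
have qp : 0 < q by rewrite sqrtr_gt0 mulr_gt0.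
have qE : q ^+ 2 = 2 * a by rewrite sqr_sqrtr// mulr_ge0// ltW.
have [r0|r0] := posnP r.
  have Q0 : Q = 0 by apply/eqP; rewrite -mxrank_eq0 -leqn0 -r0.
  rewrite (_ : [set w | _] = set0) ?measure0 ?lee_fin ?expR_ge0//.
  apply/seteqP; split => // w /=; rewrite Q0 /dotp [leRHS]big1.
    apply/negP; rewrite -ltNge mulr_gt0 ?exprn_gt0// ltr_pwDr// sqrtr_ge0//.
  by move=> i _; rewrite mul0mx mxE mul0r.
have pp : 0 < p by rewrite sqrtr_gt0 ltr0n.
have pE : p ^+ 2 = r%:R by rewrite sqr_sqrtr.
have pq : 0 < p + q by rewrite addr_gt0.
pose k := q / (2 * (p + q) * sigma ^+ 2).
have k0 : 0 < k by rewrite divr_gt0// !mulr_gt0// exprn_gt0.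
have tE : 1 - 2 * k * sigma ^+ 2 = p / (p + q).
  by rewrite /k; field; rewrite !gt_eqF.
have t0 : 0 < 1 - 2 * k * sigma ^+ 2 by rewrite tE divr_gt0.
have := @gaussian_proj_mgf _ _ _ P n sigma eps sigma0 gauss Q 0 k r pQ rQ
  (mulmx0 _ _) (ltW k0) t0.
under eq_integral do rewrite dotp0l addr0.
rewrite dotp0l mulr0 mul0r expR0 mulr1 tE => mgf.
have mG : measurable_fun setT
    (fun w => expR (k * dotp (Q *m rvec eps w) (Q *m rvec eps w))).
  apply: measurableT_comp => //; apply: measurable_funM => //.
  exact: measurable_proj_sqr.
set s := sigma ^+ 2 * (p + q) ^+ 2.
have := markov_bound mG (fun w => expR_ge0 _) (expR_gt0 (k * s)) mgf.
rewrite (_ : [set w | _] = [set w | (s <= dotp (Q *m rvec eps w) (Q *m rvec eps w))%R]); last first.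
  by apply/seteqP; split => w /=; rewrite ler_expR ler_pM2l.
move=> /le_trans; apply; rewrite lee_fin ler_pdivrMr ?expR_gt0// -expRD.
have b0 : 0 < p / (p + q) by rewrite divr_gt0.
have bl : (Num.sqrt (p / (p + q)))^-1 <= expR (q / (2 * p)).
  rewrite -sqrtrV ?(ltW b0)// -[leRHS]ger0_norm ?expR_ge0// -sqrtr_sqr ler_sqrt ?sqr_ge0//.
  rewrite -expRM_natl (_ : 2%:R * (q / (2 * p)) = q / p); last by field; rewrite gt_eqF.
  apply: le_trans (expR_ge1Dx _); rewrite invf_div mulrDl mulfV// gt_eqF//.
have -> : - a + k * s = (q / (2 * p)) *+ r.
  rewrite -mulr_natl -pE (_ : a = q ^+ 2 / 2); last by rewrite qE; field.
  by rewrite /k /s; field; rewrite !gt_eqF.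
rewrite -mulr_natl expRM_natl; apply: lerXn2r; rewrite ?nnegrE ?expR_ge0//.
Qed.

(** The rows of A are not treated one by one: the weights beta of
    [almost_auerbach] merge them into one average of cosh (lam U_i) of total
    mass N / (1 - dl), to which Markov's inequality applies.  Off the
    exceptional event, the tangent of the exponential at lam recovers the
    bound simultaneously for all h. *)
Lemma self_normalised_max M (A : 'M[K]_(M, n)) (X : 'M[K]_(n, M)) (gamma t : K) :
  (1 < n)%N -> (0 < \rank A)%N -> 0 < gamma -> 0 < t ->
  (forall i, dotp (col i X) (col i X) <= n%:R * gamma ^+ 2) ->
  let kappa := Num.sqrt ((2 * ln (2 * (\rank A)%:R) + 2 * t) / (n%:R - 1)) in
  exists B : set Omega, [/\ measurable B, (P B <= (expR (- t))%:E)%E &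
    forall w, ~ B w -> forall h,
      dotp (rvec eps w) (X *m A *m h) <=
        n%:R * (gamma * kappa) * norm_n (rvec eps w) * norm_1 (A *m h)].
Proof.
move=> n1 rA g0 t0 Xg kappa.
have n0 : (0 < n)%N by apply: ltn_trans n1.
have nR0 : 0 < n%:R :> K by rewrite ltr0n.
have nR1 : 0 < n%:R - 1 :> K by rewrite subr_gt0 ltr1n.
set N := (\rank A)%:R : K.
have N1 : 1 <= N by rewrite ler1n.
have N2 : 0 < 2 * N by lra.
have lnN : 0 <= ln (2 * N) by apply: ln_ge0; lra.
have kp : 0 < (2 * ln (2 * N) + 2 * t) / (n%:R - 1) by rewrite divr_gt0//; lra.
have k0 : 0 < kappa by rewrite sqrtr_gt0.
have k2 : (n%:R - 1) * kappa ^+ 2 = 2 * ln (2 * N) + 2 * t.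
  by rewrite sqr_sqrtr ?(ltW kp)// mulrC divfK// gt_eqF.
(* 1 / (1 - dl) is the factor gained by having n kappa^2 rather than
   (n - 1) kappa^2 in the exponent. *)
pose dl : K := 1 - expR (- kappa ^+ 2 / 2).
have ek1 : expR (- kappa ^+ 2 / 2) < 1.
  rewrite -expR0 ltr_expR mulNr oppr_lt0 divr_gt0// exprn_gt0//.
have dl01 : 0 < dl < 1.
  by rewrite subr_gt0 ek1/= ltrBlDr ltrDl expR_gt0.
have [beta [b0 bsum bA]] := almost_auerbach A dl01.
rewrite subKr -/N in bsum.
have sn0 : 0 < Num.sqrt n%:R :> K by rewrite sqrtr_gt0.
have sn2 : Num.sqrt n%:R ^+ 2 = n%:R :> K by rewrite sqr_sqrtr// ltW.
pose v i := (gamma * Num.sqrt n%:R)^-1 *: col i X.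
have v1 i : dotp (v i) (v i) <= 1.
  rewrite dotpZl dotpZr mulrA -invfM mulrC ler_pdivrMr ?mul1r; last first.
    by rewrite !mulr_gt0.
  by rewrite mulrACA -!expr2 sn2 mulrC Xg.
pose lam := Num.sqrt n%:R * kappa.
have lam0 : 0 < lam by rewrite mulr_gt0.
have lam2 : lam ^+ 2 = n%:R * kappa ^+ 2 by rewrite exprMn sn2.
pose U i w := direction (v i) (sample eps w).
pose G w := \sum_i beta i * coshR (lam * U i w).
have mcosh i : measurable_fun setT (fun w => coshR (lam * U i w)).
  have mU : measurable_fun setT (fun w => lam * U i w).
    apply: measurable_funM => //.
    exact: (measurableT_comp (measurable_direction (v i)) (measurable_sample eps)).
  apply: measurable_funM => //; apply: measurable_funD.
    exact: measurableT_comp.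
  by apply: measurableT_comp => //; exact: measurable_funN.
have mG : measurable_fun setT G.
  by apply: measurable_sum => i; apply: measurable_funM.
have G0 w : 0 <= G w by apply: sumr_ge0 => i _; rewrite mulr_ge0 ?coshR_ge0.
have EG : (\int[P]_w (G w)%:E <= (N / expR (- kappa ^+ 2 / 2) * expR (lam ^+ 2 / 2))%:E)%E.
  under eq_integral do rewrite /G -sumEFin.
  rewrite ge0_integral_sum//.
  - apply: (@le_trans _ _ (\sum_i (beta i * expR (lam ^+ 2 / 2))%:E)%E).
      apply: lee_sum => i _; under eq_integral do rewrite EFinM.
      rewrite ge0_integralZl_EFin//.
      + by rewrite EFinM lee_wpmul2l ?lee_fin// (sphere_mgf sigma0 gauss n0).
      + by move=> w _; rewrite lee_fin coshR_ge0.
      + exact/measurable_EFinP.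
    by rewrite sumEFin lee_fin -mulr_suml ler_wpM2r// expR_ge0.
  - by move=> i; apply/measurable_EFinP; apply: measurable_funM.
  - by move=> i w _; rewrite lee_fin mulr_ge0 ?coshR_ge0.
exists [set w | expR (lam ^+ 2) / 2 <= G w]; split.
- exact: measurable_ge.
- have c0 : 0 < expR (lam ^+ 2) / 2 by rewrite divr_gt0 ?expR_gt0.
  apply: le_trans (markov_bound mG G0 c0 EG) _.
  rewrite lee_fin le_eqVlt; apply/orP; left; apply/eqP.
  have -> : - t = kappa ^+ 2 / 2 + lam ^+ 2 / 2 - lam ^+ 2 + ln (2 * N).
    by rewrite lam2; lra.
  rewrite expRD lnK ?posrE// expRD expRD expRN mulNr expRN invrK.
  by field; rewrite gt_eqF// expR_gt0.
- move=> w /negP; rewrite -ltNge => Gw h; set y := A *m h.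
  pose rho := Num.sqrt (dotp (rvec eps w) (rvec eps w)).
  have TE i : dotp (col i X) (rvec eps w) = gamma * rho * U i w.
    have gn : gamma * Num.sqrt n%:R != 0 by rewrite gt_eqF// mulr_gt0.
    rewrite /U direction_sample /v dotpZl -/rho.
    have [r0|r0] := eqVneq rho 0.
      rewrite r0 mulr0 mul0r; move/eqP: r0; rewrite sqrtr_eq0 => r0.
      have -> : rvec eps w = 0 by apply/eqP; rewrite -dotp_eq0 eq_le r0 dotp_ge0.
      by rewrite /dotp big1// => j _; rewrite !mxE mulr0.
    by field; rewrite r0 !gt_eqF.
  have sumU : \sum_i `|y i 0| * `|U i w| <= lam * norm_1 y.
    have [y0|y0] := eqVneq (norm_1 y) 0.
      rewrite y0 mulr0 big1// => i _.
      by rewrite (norm_1_eq0 y0) mxE normr0 mul0r.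
    have yp : 0 < norm_1 y by rewrite lt_neqAle eq_sym y0 norm_1_ge0.
    rewrite leNgt; apply/negP => large; move: Gw; apply/negP; rewrite -leNgt.
    have tangent : norm_1 y <= \sum_i `|y i 0| * expR (lam * (`|U i w| - lam)).
      apply: (@le_trans _ _ (\sum_i `|y i 0| * (1 + lam * (`|U i w| - lam)))).
        have -> : \sum_i `|y i 0| * (1 + lam * (`|U i w| - lam)) =
            norm_1 y + lam * (\sum_i `|y i 0| * `|U i w| - lam * norm_1 y).
          rewrite /norm_1 mulr_sumr -sumrB mulr_sumr -big_split/=.
          by apply: eq_bigr => i _; ring.
        by rewrite lerDl mulr_ge0 ?(ltW lam0)// subr_ge0 ltW.
      by apply: ler_sum => i _; rewrite ler_wpM2l// expR_ge1Dx.
    have : norm_1 y <= norm_1 y * (expR (- lam ^+ 2) * (2 * G w)).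
      apply: le_trans tangent _; rewrite /G !mulr_sumr; apply: ler_sum => i _.
      have -> : lam * (`|U i w| - lam) = lam * `|U i w| - lam ^+ 2 by ring.
      rewrite expRD.
      have cosh_ge : expR (lam * `|U i w|) <= 2 * coshR (lam * U i w).
        exact: expR_normr_le_coshR.
      have yb : `|y i 0| <= beta i * norm_1 y by exact: bA.
      apply: (@le_trans _ _ ((beta i * norm_1 y) *
          (2 * coshR (lam * U i w) * expR (- lam ^+ 2)))).
        apply: ler_pM => //.
        by rewrite ler_wpM2r// expR_ge0.
      by rewrite le_eqVlt; apply/orP; left; apply/eqP; ring.
    rewrite -{1}[norm_1 y]mulr1 ler_pM2l// expRN mulrC.
    by rewrite ler_pdivlMr ?expR_gt0// mul1r ler_pdivrMr// [G w * 2]mulrC.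
  have rhoE : rho = Num.sqrt n%:R * norm_n (rvec eps w).
    by rewrite norm_nE -sqrtrM// mulrC divfK// gt_eqF.
  rewrite -mulmxA -/y.
  have -> : dotp (rvec eps w) (X *m y) = \sum_i gamma * rho * (U i w * y i 0).
    have -> : dotp (rvec eps w) (X *m y) = \sum_i dotp (col i X) (rvec eps w) * y i 0.
      rewrite {1}/dotp; under eq_bigr do rewrite [X in _ * X]mxE mulr_sumr.
      rewrite exchange_big/=; apply: eq_bigr => i _.
      by rewrite mulr_suml; apply: eq_bigr => j _; rewrite [col i X j 0]mxE; ring.
    by apply: eq_bigr => i _; rewrite TE mulrA.
  rewrite -mulr_sumr.
  have rho0 : 0 <= gamma * rho by rewrite mulr_ge0 ?sqrtr_ge0 ?(ltW g0).
  apply: (@le_trans _ _ (gamma * rho * (lam * norm_1 y))).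
    rewrite ler_wpM2l//; apply: le_trans sumU; apply: ler_sum => i _.
    by rewrite mulrC -normrM ler_norm.
  rewrite le_eqVlt; apply/orP; left; apply/eqP.
  by rewrite rhoE /lam -[in RHS]sn2; ring.
Qed.

End Events.

(** * Residuals of the square root analysis estimator *)

Section Geometry.
Context {K : realType} {m n : nat} (D : 'M[K]_(m, n)) (S : {set 'I_m}).

Let A := drop_rows D S.
Let X := Defs.pinv A.

(** The orthogonal projection onto the null space of D_{-S}. *)
Definition null_proj : 'M[K]_n := 1%:M - X *m A.

Lemma orth_proj_null_proj : orth_proj null_proj.
Proof.
have [E1 E2 E3 E4] := pinvP A.
split; rewrite /null_proj; first by rewrite linearB/= trmx1 E4.
by rewrite mulmxBr mulmx1 mulmxBl mul1mx mulmxA E2 subrr subr0.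
Qed.

Lemma mxrank_null_proj : (\rank null_proj <= null_dim D S)%N.
Proof.
have [E1 E2 E3 E4] := pinvP A.
apply: mxrankS; apply/sub_kermxP; rewrite -(orth_proj_null_proj.1) -trmx_mul.
by rewrite /null_proj mulmxBr mulmx1 mulmxA E1 subrr trmx0.
Qed.

Lemma null_dimE : (null_dim D S = n - \rank A)%N.
Proof. by rewrite /null_dim mxrank_ker mxrank_tr. Qed.

(** The number of directions that R pays for is the rank of D_{-S}, which may
    be smaller than its number of rows. *)
Lemma mxrank_drop_rows : n%:R - (null_dim D S)%:R = (\rank A)%:R :> K.
Proof. by rewrite null_dimE natrB ?rank_leq_col// subKr. Qed.

Lemma norm_1_drop_rows h : norm_1 (A *m h) <= norm_1 (D *m h).
Proof.
rewrite /norm_1.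
have -> : \sum_(i < #|~: S|) `|(A *m h) i 0| = \sum_(j in ~: S) `|(D *m h) j 0|.
  rewrite [RHS]big_enum_val/=; apply: eq_bigr => i _; congr `|_|; rewrite !mxE.
  by apply: eq_bigr => k _; rewrite !mxE.
by rewrite [leRHS](bigID (mem (~: S)))/= lerDl sumr_ge0.
Qed.

Lemma scaling_factor_ge i : norm_n (col i X) <= scaling_factor D S.
Proof. exact: (le_bigmax _ (fun i => norm_n (col i X))). Qed.

Lemma scaling_factor_ge0 : 0 <= scaling_factor D S.
Proof.
rewrite /scaling_factor; elim/big_ind : _ => // [x y x0 y0|i _].
  by rewrite le_max x0.
exact: norm_n_ge0.
Qed.

Lemma scaling_factor_gt0 : (0 < n)%N -> (0 < \rank A)%N -> 0 < scaling_factor D S.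
Proof.
move=> n0 rA; rewrite lt_neqAle scaling_factor_ge0 andbT eq_sym.
apply: contraTneq rA => g0; rewrite -leqNgt leqn0 mxrank_eq0.
have X0 : X = 0.
  apply/matrixP => i j; have := scaling_factor_ge j; rewrite g0 => le0.
  have : norm_n (col j X) ^+ 2 = 0.
    by apply/eqP; rewrite sqrf_eq0 eq_le le0 norm_n_ge0.
  rewrite sqr_norm_n => /eqP; rewrite mulf_eq0 invr_eq0 pnatr_eq0.
  rewrite (gtn_eqF n0) orbF dotp_eq0 => /eqP/colP/(_ i); by rewrite !mxE.
by have [<- _ _ _] := pinvP A; rewrite -/X X0 mulmx0 mul0mx.
Qed.

End Geometry.

Theorem lemma3p1 (K : realType) (d : measure_display) (Omega : measurableType d)
    (P : probability Omega K) (m n : nat)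
    (f0 : 'cV[K]_n) (sigma : K) (hsigma : 0 < sigma)
    (eps : 'I_n -> {RV P >-> K}) (heps : isotropic_gaussian sigma eps)
    (D : 'M[K]_(m, n)) (S : {set 'I_m}) (hS : active_sets D S)
    (a eta t R lambda0 c : K)
    (ha : 0 < a) (heta : 0 < eta < 1)
    (ht : 0 < t < (n%:R - 1) / 2 - ln (2 * (n%:R - (null_dim D S)%:R)))
    (hR : scaling_factor D S *
            Num.sqrt ((2 * ln (2 * (n%:R - (null_dim D S)%:R)) + 2 * t)
                      / (n%:R - 1)) <= R)
    (hR0 : 0 < R)
    (hna : 8 * a < n%:R)
    (hlambda0 : R / (1 - eta) <= lambda0)
    (hc : c = Num.sqrt ((eta / 2 -
                (Num.sqrt (null_dim D S)%:R + Num.sqrt (2 * a))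
                / Num.sqrt (n%:R - Num.sqrt (8 * a * n%:R))) ^+ 2 + 4) - 2)
    (hf0 : norm_1 (D *m f0) <=
             c * sigma * Num.sqrt (1 - Num.sqrt (8 * a / n%:R)) / lambda0)
    (hSeta : 2 * ((Num.sqrt (null_dim D S)%:R + Num.sqrt (2 * a))
                  / Num.sqrt (n%:R - Num.sqrt (8 * a * n%:R))) < eta)
    (fhat : Omega -> 'cV[K]_n)
    (hfhat : forall w,
       sqrt_analysis_estimate D lambda0 (f0 + rvec eps w) (fhat w)) :
  exists A : set Omega,
    [/\ measurable A,
        ((1 - 3 * expR (- a) - expR (- t))%:E <= P A)%E
      & forall w, A w ->
          `| norm_n (f0 + rvec eps w - fhat w) / norm_n (rvec eps w) - 1 |
            <= eta ].
Proof.
have nR0 : 0 < n%:R :> K by apply: lt_trans hna; rewrite mulr_gt0.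
have n0 : (0 < n)%N by rewrite -(ltr0n K).
set A := drop_rows D S; set X := Defs.pinv A; set Q := null_proj D S.
set r := null_dim D S in ht hR hc hSeta *.
rewrite mxrank_drop_rows -/A in ht hR.
case/andP: ht => t0 tn.
(* For rank 0 the logarithm is ln 0 = 0; in both cases it is nonnegative. *)
have n1 : (1 < n)%N.
  rewrite -(ltr_nat K); have : 0 <= ln (2 * (\rank A)%:R) :> K.
    have [->|rA] := posnP (\rank A); first by rewrite mulr0 ln0.
    by apply: ln_ge0; have : 1 <= (\rank A)%:R :> K by [rewrite ler1n]; lra.
  by lra.
set u := Num.sqrt (8 * a * n%:R) in hc hSeta.
have u_lt : u < n%:R.
  rewrite /u -[ltRHS]ger0_norm ?ltW// -sqrtr_sqr ltr_sqrt ?exprn_gt0//.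
  by rewrite expr2 ltr_pM2r.
have nu0 : 0 < n%:R - u by rewrite subr_gt0.
have uE : Num.sqrt (8 * a / n%:R) = u / n%:R.
  have -> : 8 * a / n%:R = 8 * a * n%:R / n%:R ^+ 2 by field; rewrite gt_eqF.
  rewrite sqrtrM; last by rewrite !mulr_ge0// ltW.
  by rewrite sqrtrV ?sqr_ge0// sqrtr_sqr ger0_norm ?ltW.
have gap : 1 - Num.sqrt (8 * a / n%:R) = (n%:R - u) / n%:R.
  by rewrite uE; field; rewrite gt_eqF.
set s := Num.sqrt r%:R + Num.sqrt (2 * a) in hc hSeta.
have s0 : 0 <= s by rewrite addr_ge0 ?sqrtr_ge0.
set q := s / Num.sqrt (n%:R - u) in hc hSeta.
have q0 : 0 <= q by rewrite divr_ge0 ?sqrtr_ge0.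
have eta1 : 0 < 1 - eta by rewrite subr_gt0; case/andP: heta.
have l0 : 0 < lambda0 by apply: lt_le_trans hlambda0; rewrite divr_gt0.
pose B1 := [set w | dotp (rvec eps w) (rvec eps w) <= sigma ^+ 2 * (n%:R - u)].
pose B2 := [set w | sigma ^+ 2 * s ^+ 2 <= dotp (Q *m rvec eps w) (Q *m rvec eps w)].
have PB1 : (P B1 <= (expR (- a))%:E)%E by exact: (gaussian_lower_tail hsigma heps).
have PB2 : (P B2 <= (expR (- a))%:E)%E.
  apply: (gaussian_upper_tail hsigma heps) => //; first exact: orth_proj_null_proj.
  exact: mxrank_null_proj.
have [B3 [mB3 PB3 HB3]] : exists B : set Omega, [/\ measurable B,
    (P B <= (expR (- t))%:E)%E & forall w, ~ B w -> forall h,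
    dotp (rvec eps w) (X *m A *m h) / n%:R <=
      R * norm_n (rvec eps w) * norm_1 (D *m h)].
  (* If D_{-S} = 0 there is nothing to control, and the scaling factor is 0. *)
  have [rA|rA] := posnP (\rank A).
    exists set0; split => //; first by rewrite measure0 lee_fin expR_ge0.
    move=> w _ h; have -> : A = 0 by apply/eqP; rewrite -mxrank_eq0 rA.
    rewrite mulmx0 mul0mx /dotp big1 ?mul0r; last by move=> i _; rewrite !mxE mulr0.
    by rewrite !mulr_ge0 ?norm_n_ge0 ?norm_1_ge0// ltW.
  have g0 := scaling_factor_gt0 n0 rA.
  have [|B [mB PB HB]] := self_normalised_max hsigma heps (A := A) (X := X) n1 rA g0 t0.
    move=> i; rewrite -ler_pdivrMl// mulrC -sqr_norm_n.
    by apply: lerXn2r; rewrite ?nnegrE ?norm_n_ge0 ?(ltW g0)// scaling_factor_ge.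
  exists B; split => // w Bw h; rewrite ler_pdivrMr//.
  apply: le_trans (HB w Bw h) _.
  rewrite -[n%:R * _ * _]mulrA -[n%:R * _ * _]mulrA [leRHS]mulrC ler_pM2l//.
  apply: ler_pM; rewrite ?norm_1_ge0//.
  - by rewrite mulr_ge0 ?norm_n_ge0// mulr_ge0 ?sqrtr_ge0 ?(ltW g0).
  - by rewrite ler_wpM2r ?norm_n_ge0.
  - exact: norm_1_drop_rows.
have mB1 : measurable B1.
  rewrite (_ : B1 = [set w | - (sigma ^+ 2 * (n%:R - u)) <= - dotp (rvec eps w) (rvec eps w)]).
    by apply: measurable_ge; apply: measurable_funN; exact: measurable_sqr_rvec.
  by apply/seteqP; split => w; rewrite /B1/= lerN2.
have mB2 : measurable B2.
  by apply: measurable_ge; exact: measurable_proj_sqr.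
exists (~` (B1 `|` B2 `|` B3)); split.
- by apply: measurableC; apply: measurableU => //; exact: measurableU.
- have mU12 : measurable (B1 `|` B2) by exact: measurableU.
  have mU : measurable (B1 `|` B2 `|` B3) by exact: measurableU.
  have PU : (P (B1 `|` B2 `|` B3) <= (expR (- a) + expR (- a) + expR (- t))%:E)%E.
    apply: le_trans (measureU2 _ mU12 mB3) _; rewrite EFinD leeD//.
    by apply: le_trans (measureU2 _ mB1 mB2) _; rewrite EFinD leeD.
  rewrite probability_setC//.
  have finU := fin_num_measure P _ mU.
  move: PU; rewrite -(fineK finU) -EFinB !lee_fin.
  by have := expR_ge0 (- a); lra.
- move=> w /not_orP[/not_orP[wB1 wB2] wB3].
  set e := rvec eps w in wB1 wB2 *.
  have e2 : sigma ^+ 2 * (n%:R - u) < dotp e e by rewrite ltNge; apply/negP.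
  have Qe2 : dotp (Q *m e) (Q *m e) < sigma ^+ 2 * s ^+ 2 by rewrite ltNge; apply/negP.
  have e_low : sigma * Num.sqrt (1 - Num.sqrt (8 * a / n%:R)) < norm_n e.
    rewrite gap norm_nE -[sigma]gtr0_norm// -sqrtr_sqr -sqrtrM ?sqr_ge0//.
    rewrite ltr_sqrt; last first.
      by rewrite divr_gt0//; apply: lt_trans e2; rewrite mulr_gt0// exprn_gt0.
    by rewrite mulrA ltr_pM2r ?invr_gt0.
  have e0 : 0 < norm_n e.
    by apply: le_lt_trans e_low; rewrite mulr_ge0 ?sqrtr_ge0// ltW.
  have Qe : norm_n (Q *m e) <= q * norm_n e.
    rewrite -[leRHS]ger0_norm; last by rewrite mulr_ge0// ltW.
    rewrite -sqrtr_sqr norm_nE ler_sqrt ?sqr_ge0//.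
    rewrite exprMn sqr_norm_n mulrA ler_pM2r ?invr_gt0//.
    rewrite /q expr_div_n sqr_sqrtr ?(ltW nu0)//.
    apply: (@le_trans _ _ (sigma ^+ 2 * s ^+ 2)); first exact: ltW.
    rewrite [leRHS]mulrAC ler_pdivlMr//.
    have -> : sigma ^+ 2 * s ^+ 2 * (n%:R - u) = s ^+ 2 * (sigma ^+ 2 * (n%:R - u)) by ring.
    by rewrite ler_wpM2l ?sqr_ge0// ltW.
  apply: (@residual_norm_close _ _ _ D f0 e (fhat w) eta q c R lambda0) => //.
  + rewrite mulrC -ler_pdivlMr//.
    apply: le_trans hf0 _; rewrite ler_pM2r ?invr_gt0// -mulrA.
    apply: ler_wpM2l; last exact: ltW.
    rewrite hc subr_ge0 -[leLHS]ger0_norm// -sqrtr_sqr ler_sqrt ?addr_ge0 ?sqr_ge0//.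
    by have := sqr_ge0 (eta / 2 - q); lra.
  + move=> h.
    have -> : dotp e h = dotp (Q *m e) h + dotp e (X *m A *m h).
      have -> : dotp (Q *m e) h = dotp e (Q *m h).
        by rewrite !dotpE trmx_mul (orth_proj_null_proj D S).1 mulmxA.
      by rewrite -dotpDr -mulmxDl /Q /null_proj subrK mul1mx.
    rewrite mulrDl lerD//; last exact: HB3.
    apply: le_trans (dotp_le _ _) _.
    by rewrite ler_wpM2r ?norm_n_ge0.
  + exact: hfhat.
Qed.
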